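(* Let $\mathcal{A}\in\mathbb{R}^{N\times N}$, $\mathcal{B}\in\mathbb{R}^{N\times P}$, $\mathcal{C}\in\mathbb{R}^{Q\times N}$ be such that the linear system $\dot\xi(t)=\mathcal{A}\xi(t)+\mathcal{B}u(t)$, $y(t)=\mathcal{C}\xi(t)$ is input-output stable. Let $\|\cdot\|$ denote the matrix norm induced by the vector $p$-norm for a fixed $p\in[1,\infty]$. Suppose there are constants $\beta>1$, $M>0$ and $K>0$ such that $$\|\mathcal{C}(sI-\mathcal{A})^{-1}\mathcal{B}\|\le M|s|^{-\beta}\qquad\text{for all } s\in\mathbb{C} \text{ with } |s|\ge K.$$ Then for all $t\ge 0$ $$\|\mathcal{C}e^{t\mathcal{A}}\mathcal{B}\|\le \frac{1}{2\pi}\int_{-\infty}^{\infty}\|\mathcal{C}(i\omega I-\mathcal{A})^{-1}\mathcal{B}\|\,\mathrm{d}\omega<\infty.$$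
   Context: The vector $p$-norms are $\|x\|_p=(\sum_k|x_k|^p)^{1/p}$ for $1\le p<\infty$ and $\|x\|_\infty=\max_k|x_k|$ for complex vectors; the induced matrix norm is $\|M\|=\sup_{\|x\|_p=1}\|Mx\|_p$ (same $p$ on domain and codomain). The transfer matrix $\mathcal{C}(sI-\mathcal{A})^{-1}\mathcal{B}$ is regarded as a matrix of rational functions of $s\in\mathbb{C}$ (so removable singularities at eigenvalues of $\mathcal{A}$ are removed). The system is called input-output stable if all poles of this transfer matrix lie in the open left half plane $\{\operatorname{Re} s<0\}$ ($\mathcal{A}$ itself may have other eigenvalues that are not poles of the transfer matrix). *)

(* Defs.v *)
From HB Require Import structures.
From mathcomp Require Import all_boot all_order all_algebra.
From mathcomp Require Import all_classical all_reals all_analysis.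
From mathcomp Require Import complex.

Set Implicit Arguments.
Unset Strict Implicit.
Unset Printing Implicit Defensive.

Import Order.TTheory GRing.Theory Num.Theory.
Import numFieldNormedType.Exports.

Local Open Scope classical_set_scope.
Local Open Scope ring_scope.
Local Open Scope complex_scope.

(* [Normc.normc] is the [R]-valued modulus; the generic norm of [R[i]] takes
   its values in [R[i]]. *)
Definition cabs (R : realType) (z : R[i]) : R := ComplexField.Normc.normc z.

(* Meant for [1 <= p]; the value at [-oo] is a dummy. *)
Definition pnorm (R : realType) (p : \bar R) (n : nat) (x : 'cV[R[i]]_n) : R :=
  match p with
  | r%:E => (\sum_(k < n) cabs (x k 0) `^ r) `^ r^-1
  | +oo%E => \big[Num.max/0]_(k < n) cabs (x k 0)
  | -oo%E => 0
  end.

(* If [n = 0] there is no vector of norm 1, and the supremum of the empty set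
   is 0. *)
Definition opnorm (R : realType) (p : \bar R) (m n : nat)
    (M : 'M[R[i]]_(m, n)) : R :=
  sup [set pnorm p (M *m x) | x in [set x : 'cV[R[i]]_n | pnorm p x = 1]].

Definition cplxmx (R : realType) (m n : nat) (M : 'M[R]_(m, n)) :
  'M[R[i]]_(m, n) := map_mx (fun a : R => a%:C) M.

Definition expmx (R : realType) (n : nat) (A : 'M[R]_n) : 'M[R]_n :=
  limn (series (fun k : nat => (k`!%:R)^-1 *: A ^+ k)).

(* The representative of a class in [{fraction {poly F}}] need not be in lowest
   terms; the common factor is divided out so that removable singularities
   are neither poles nor obstacles to evaluation. *)
Definition ratf_num (F : fieldType) (f : {fraction {poly F}}) : {poly F} :=
  let r := frac (repr f) in r.1 %/ gcdp r.1 r.2.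

Definition ratf_den (F : fieldType) (f : {fraction {poly F}}) : {poly F} :=
  let r := frac (repr f) in r.2 %/ gcdp r.1 r.2.

Definition ratf_pole (F : fieldType) (f : {fraction {poly F}}) (z : F) : bool :=
  root (ratf_den f) z.

(* Equal to 0 at the poles of [f], by the convention [0^-1 = 0]. *)
Definition ratf_eval (F : fieldType) (f : {fraction {poly F}}) (z : F) : F :=
  (ratf_num f).[z] / (ratf_den f).[z].

Definition ratf_cst (R : realType) (a : R) : {fraction {poly R[i]}} :=
  tofrac ((a%:C)%:P).

(* [C (sI - A)^-1 B] over the field of rational functions in the indeterminate
   [s], where [sI - A] is invertible: its determinant is the characteristic
   polynomial of [A]. *)
Definition transfer (R : realType) (N P Q : nat)
    (A : 'M[R]_N) (B : 'M[R]_(N, P)) (C : 'M[R]_(Q, N)) :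
    'M[{fraction {poly R[i]}}]_(Q, P) :=
  let s : {fraction {poly R[i]}} := tofrac 'X in
  map_mx (@ratf_cst R) C *m invmx (s%:M - map_mx (@ratf_cst R) A)
    *m map_mx (@ratf_cst R) B.

Definition transfer_at (R : realType) (N P Q : nat)
    (A : 'M[R]_N) (B : 'M[R]_(N, P)) (C : 'M[R]_(Q, N)) (s : R[i]) :
    'M[R[i]]_(Q, P) :=
  map_mx (fun f => ratf_eval f s) (transfer A B C).

Definition io_stable (R : realType) (N P Q : nat)
    (A : 'M[R]_N) (B : 'M[R]_(N, P)) (C : 'M[R]_(Q, N)) : Prop :=
  forall (i : 'I_Q) (j : 'I_P) (z : R[i]),
    ratf_pole (transfer A B C i j) z -> complex.Re z < 0.

(* Main.v *)
Require Import Defs.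
From mathcomp Require Import all_boot all_order all_algebra.
From mathcomp Require Import all_classical all_reals all_analysis.
From mathcomp Require Import measurable_realfun.
From mathcomp Require Import complex.
From mathcomp Require Import ring lra zify.

(** The inequality is the triangle inequality applied to the inversion formula
    [C e^(tA) B = (1 / 2 pi) int H(i omega) e^(i omega t) d omega], where
    [H(s) = C (s - A)^-1 B]. Instead of deforming a contour, the formula is
    replaced by its discrete counterpart, for which inversion is a finite
    identity, and the triangle inequality is taken before passing to the limit.
    Only integrals of nonnegative real functions occur.

    Let [G = 1 + h A] be one explicit Euler step of size [h > 0]. The generating
    function of the iterates [C G^m B] is [H] evaluated at [s = (w - 1) / h]: up
    to a remainder,
      [h sum_(m < n) w^(n-1-m) C G^m B = w^n H(s)]
    ([euler_generating]). Averaging over the [n] points [w] with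
    [w^n = (-1)^n] extracts a single iterate ([euler_dft]), and since
    [|w| = 1],
      [||C G^k B|| <= (1 / n h) sum_w ||H((w - 1) / h)|| + remainder]
    ([euler_opnorm_bound]), uniformly in [k < n].

    Stability makes the remainder vanish as [n] grows. An eigenvalue of [A]
    that is not a pole must not be felt, so each entry of [H] is written in lowest
    terms [n / d] and [A] is only used between the corresponding row [c] of [C] and
    column [b] of [B]: there [d(A)] is invisible, and [n(s) / d(s)] is [c q(A) b]
    for an explicit polynomial [q] depending on [s] ([resolvent_fraction]). Every
    root [z] of [d] then contributes a factor [1 + h z] to the growth of
    [c G^m b], and [|1 + h z| < 1] for small [h] because [Re z < 0]
    ([decay_krylov]).

    With [w = e^(i h omega)], the sum over [w] is [1 / 2 pi] times the integral of
    a step function of [omega]. As [h -> 0], the points [(w - 1) / h] tend to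
    [i omega]. They lie on a circle tangent to the imaginary axis at the
    origin, satisfy [|s| >= |omega| / 2], and on [|s| <= K] have real part close
    to 0; hence the step functions are dominated by a multiple of
    [(1 + |omega|)^(-beta)] ([opnorm_transfer_decay]), which is integrable because
    [beta > 1]. Dominated convergence gives the integral of [||H(i omega)||]
    ([euler_limit_le]).

    On the other side, [(1 + (t / m) A)^m] tends to [e^(tA)]
    ([cvg_euler_expmx]). For [t = 0] the bound is used with [k = 0]. *)

Set Implicit Arguments.
Unset Strict Implicit.

Import Order.TTheory GRing.Theory Num.Theory.
Import numFieldNormedType.Exports.

Local Open Scope classical_set_scope.
Local Open Scope ring_scope.
Local Open Scope complex_scope.

(** * The modulus, the vector norms and the induced norms *)

Section Modulus.
Variable R : realType.
Implicit Types z w : R[i].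

Lemma cabs_ge0 z : 0 <= cabs z.
Proof. by case: z => a b; exact: sqrtr_ge0. Qed.

Lemma cabs0 : cabs (0 : R[i]) = 0.
Proof. exact: Normc.normc0. Qed.

Lemma cabs1 : cabs (1 : R[i]) = 1.
Proof. exact: Normc.normc1. Qed.

Lemma cabsM z w : cabs (z * w) = cabs z * cabs w.
Proof. exact: Normc.normcM. Qed.

Lemma cabsD z w : cabs (z + w) <= cabs z + cabs w.
Proof. exact: le_normcD. Qed.

Lemma cabsN z : cabs (- z) = cabs z.
Proof. exact: normcN. Qed.

Lemma cabsB z w : cabs (z - w) = cabs (w - z).
Proof. by rewrite -cabsN opprB. Qed.

Lemma cabsV z : cabs z^-1 = (cabs z)^-1.
Proof. exact: Normc.normcV. Qed.

Lemma cabsX z n : cabs (z ^+ n) = cabs z ^+ n.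
Proof.
by elim: n => [|n IH]; rewrite ?expr0 ?cabs1// !exprS cabsM IH.
Qed.

Lemma cabs_eq0 z : (cabs z == 0) = (z == 0).
Proof.
by apply/eqP/eqP => [/Normc.eq0_normc//|->]; rewrite cabs0.
Qed.

Lemma cabs_gt0 z : (0 < cabs z) = (z != 0).
Proof. by rewrite lt_neqAle cabs_ge0 andbT eq_sym cabs_eq0. Qed.

Lemma cabs_real (a : R) : cabs a%:C = `|a|.
Proof. by rewrite /cabs /= expr0n addr0 sqrtr_sqr. Qed.

Lemma cabs_sqr z : cabs z ^+ 2 = complex.Re z ^+ 2 + complex.Im z ^+ 2.
Proof. by case: z => a b; rewrite /cabs /= sqr_sqrtr // addr_ge0 ?sqr_ge0. Qed.

Lemma normRe_cabs z : `|complex.Re z| <= cabs z.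
Proof.
rewrite -(@ler_pXn2r _ 2)// ?nnegrE ?cabs_ge0//.
by rewrite cabs_sqr -normrX ger0_norm ?sqr_ge0// lerDl sqr_ge0.
Qed.

Lemma cabs_sum (I : Type) (r : seq I) (P : pred I) (F : I -> R[i]) :
  cabs (\sum_(i <- r | P i) F i) <= \sum_(i <- r | P i) cabs (F i).
Proof.
elim/big_ind2 : _ => [|x1 x2 y1 y2 h1 h2|//]; first by rewrite cabs0.
by rewrite (le_trans (cabsD _ _))// lerD.
Qed.

Lemma cabs_convex z w (t : R) : 0 <= t -> t <= 1 ->
  cabs (t%:C * z + (1 - t)%:C * w) <= t * cabs z + (1 - t) * cabs w.
Proof.
move=> t0 t1; rewrite (le_trans (cabsD _ _))// !cabsM !cabs_real !ger0_norm//.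
by rewrite subr_ge0.
Qed.

Lemma cabs_i : cabs (0 +i* 1 : R[i]) = 1.
Proof. by rewrite /cabs /= expr0n add0r expr1n sqrtr1. Qed.

Lemma axisB (u v : R) :
  (0 +i* u) - (0 +i* v) = (0 +i* 1) * (u - v)%:C :> R[i].
Proof.
by apply/eqP; rewrite eq_complex /=; apply/andP; split; apply/eqP; ring.
Qed.

End Modulus.

Lemma convex_le1 (R : realType) (t u v : R) :
  0 <= t -> t <= 1 -> u <= 1 -> v <= 1 -> t * u + (1 - t) * v <= 1.
Proof. by move=> t0 t1 u1 v1; nra. Qed.

Lemma powR_inv_le1 (R : realType) (r S : R) : 0 < r -> 0 <= S ->
  (S `^ r^-1 <= 1) = (S <= 1).
Proof.
move=> r0 S0; have {1}<- : (1 : R) `^ r^-1 = 1 by rewrite powR1.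
apply/idP/idP; last by apply: ge0_ler_powR; rewrite ?invr_ge0 ?nnegrE// ltW.
apply: contraTT; rewrite -!ltNge; apply: gt0_ltr_powR; rewrite ?nnegrE//.
by rewrite invr_gt0.
Qed.

Lemma sumr_powR_ge0 (R : realType) (n : nat) (a : 'I_n -> R) (r : R) :
  0 <= \sum_(k < n) a k `^ r.
Proof. by apply: sumr_ge0 => k _; exact: powR_ge0. Qed.

Section VectorNorm.
Variables (R : realType) (p : \bar R).
Hypothesis p1 : (1 <= p)%E.
Implicit Types n : nat.

Lemma pnorm_ge0 n (x : 'cV[R[i]]_n) : 0 <= pnorm p x.
Proof.
rewrite /pnorm; case: p => [r||] //; first exact: powR_ge0.
by elim/big_ind: _ => // [u v u0 v0|i _]; rewrite ?cabs_ge0// le_max u0.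
Qed.

Lemma cabs_le_pnorm n (x : 'cV[R[i]]_n) k : cabs (x k 0) <= pnorm p x.
Proof.
case: p p1 => [r||] //=.
- rewrite lee_fin => r1; have r0 : 0 < r by rewrite (lt_le_trans _ r1).
  rewrite -{1}[cabs (x k 0)]powRr1 ?cabs_ge0// -(mulfV (lt0r_neq0 r0)) powRrM.
  rewrite ge0_ler_powR ?invr_ge0 ?(ltW r0)// ?nnegrE ?powR_ge0//.
    exact: sumr_powR_ge0.
  by rewrite (bigD1 k)//= lerDl; apply: sumr_ge0 => i _; rewrite powR_ge0.
- by move=> _; exact: (le_bigmax 0 (fun k => cabs (x k 0))).
Qed.

Lemma pnorm0 n : pnorm p (0 : 'cV[R[i]]_n) = 0.
Proof.
case: p p1 => [r||] //=.
- rewrite lee_fin => r1; have r0 : r != 0 by rewrite gt_eqF// (lt_le_trans _ r1).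
  by rewrite big1 ?powR0 ?invr_eq0// => k _; rewrite mxE cabs0 powR0.
- by move=> _; apply: big1_idem => [|k _]; [exact: maxxx | rewrite mxE cabs0].
Qed.

Lemma pnorm_eq0 n (x : 'cV[R[i]]_n) : pnorm p x = 0 -> x = 0.
Proof.
move=> x0; apply/matrixP => k j; rewrite ord1 mxE; apply/eqP.
by rewrite -cabs_eq0 eq_le cabs_ge0 andbT -x0 cabs_le_pnorm.
Qed.

Lemma pnormZ n a (x : 'cV[R[i]]_n) : pnorm p (a *: x) = cabs a * pnorm p x.
Proof.
case: p p1 => [r||] //=.
- rewrite lee_fin => r1; have r0 : 0 < r by rewrite (lt_le_trans _ r1).
  under eq_bigr do rewrite mxE cabsM powRM ?cabs_ge0//.
  rewrite -mulr_sumr powRM ?powR_ge0//; last first.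
    exact: sumr_powR_ge0.
  by rewrite -powRrM mulfV ?gt_eqF// powRr1 ?cabs_ge0.
- move=> _; rewrite (big_morph (fun u => cabs a * u) (id1 := 0) (op1 := Num.max)).
  + by apply: eq_bigr => k _; rewrite mxE cabsM.
  + by move=> u v; rewrite maxr_pMr ?cabs_ge0.
  + by rewrite mulr0.
Qed.

(** Convexity of the unit ball; together with homogeneity it is equivalent to
    the triangle inequality, and for finite exponents it is immediate from the
    convexity of the power function. *)
Lemma pnorm_ball_convex n (x y : 'cV[R[i]]_n) (t : R) : 0 <= t -> t <= 1 ->
  pnorm p x <= 1 -> pnorm p y <= 1 ->
  pnorm p (t%:C *: x + (1 - t)%:C *: y) <= 1.
Proof.
move=> t0 t1.
case: p p1 => [r r1|_|//]; rewrite /pnorm.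
- move: r1; rewrite lee_fin => r1; have r0 : 0 < r by rewrite (lt_le_trans _ r1).
  have le1 (z : 'cV[R[i]]_n) := powR_inv_le1 r0 (sumr_powR_ge0 (fun k => cabs (z k 0)) r).
  move=> x1 y1; rewrite (le1 x) in x1; rewrite (le1 y) in y1.
  rewrite le1 {le1}.
  apply: (@le_trans _ _ (t * \sum_(k < n) cabs (x k 0) `^ r +
            (1 - t) * \sum_(k < n) cabs (y k 0) `^ r)).
    rewrite !mulr_sumr -big_split/=; apply: ler_sum => k _.
    apply: (@le_trans _ _
      ((t * cabs (x k 0) + (1 - t) * cabs (y k 0)) `^ r)).
      apply: ge0_ler_powR; rewrite ?(ltW r0) ?nnegrE ?cabs_ge0//; last first.
        by rewrite !mxE; exact: cabs_convex.
      by rewrite addr_ge0// mulr_ge0 ?cabs_ge0 ?subr_ge0.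
    apply: (convex_powR r1 (Itv01 t0 t1));
    by rewrite inE/= in_itv/= andbT cabs_ge0.
  exact: convex_le1.
- move=> x1 y1; apply: bigmax_le => // k _.
  have cx : cabs (x k 0) <= 1.
    by apply: le_trans x1; exact: (le_bigmax 0 (fun k => cabs (x k 0))).
  have cy : cabs (y k 0) <= 1.
    by apply: le_trans y1; exact: (le_bigmax 0 (fun k => cabs (y k 0))).
  rewrite !mxE (le_trans (cabs_convex _ _ t0 t1))//.
  exact: convex_le1.
Qed.

Lemma pnorm_normalize n (x : 'cV[R[i]]_n) (a : R) : 0 < a -> pnorm p x = a ->
  pnorm p ((a^-1)%:C *: x) = 1.
Proof.
move=> a0 xa; rewrite pnormZ cabs_real xa ger0_norm ?mulVf ?gt_eqF//.
by rewrite invr_ge0 ltW.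
Qed.

Lemma pnormD n (x y : 'cV[R[i]]_n) : pnorm p (x + y) <= pnorm p x + pnorm p y.
Proof.
have [/pnorm_eq0 ->|x0] := eqVneq (pnorm p x) 0; first by rewrite add0r pnorm0 add0r.
have [/pnorm_eq0 ->|y0] := eqVneq (pnorm p y) 0; first by rewrite addr0 pnorm0 addr0.
have : 0 < pnorm p x by rewrite lt_neqAle eq_sym x0 pnorm_ge0.
have : 0 < pnorm p y by rewrite lt_neqAle eq_sym y0 pnorm_ge0.
move: (erefl (pnorm p x)) (erefl (pnorm p y)) => {x0 y0}.
move: {2 3 4}(pnorm p x) {2 3 4}(pnorm p y) => a b xa yb b0 a0.
have ab0 : 0 < a + b by rewrite addr_gt0.
have t0 : 0 <= a / (a + b) by rewrite divr_ge0 ?(ltW a0) ?(ltW ab0).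
have t1 : a / (a + b) <= 1 by rewrite ler_pdivrMr// mul1r lerDl ltW.
have Ea : a / (a + b) / a = (a + b)^-1 by field; rewrite ?gt_eqF.
have Eb : (1 - a / (a + b)) / b = (a + b)^-1 by field; rewrite ?gt_eqF.
have := @pnorm_ball_convex n ((a^-1)%:C *: x) ((b^-1)%:C *: y) _ t0 t1.
rewrite (pnorm_normalize a0 xa) (pnorm_normalize b0 yb) => /(_ (lexx _) (lexx _)).
rewrite !scalerA -!rmorphM/= Ea Eb -scalerDr pnormZ cabs_real.
by rewrite (gtr0_norm (x := (a + b)^-1)) ?invr_gt0// ler_pdivrMl// mulr1.
Qed.

Lemma pnorm_sum n (I : Type) (r : seq I) (P : pred I) (F : I -> 'cV[R[i]]_n) :
  pnorm p (\sum_(i <- r | P i) F i) <= \sum_(i <- r | P i) pnorm p (F i).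
Proof.
elim/big_ind2 : _ => [|x1 x2 y1 y2 h1 h2|//]; first by rewrite pnorm0.
by rewrite (le_trans (pnormD _ _))// lerD.
Qed.

Lemma pnorm_delta n (k : 'I_n) : pnorm p (delta_mx k 0 : 'cV[R[i]]_n) <= 1.
Proof.
case: p p1 => [r||] //=.
- rewrite lee_fin => r1; have r0 : 0 < r by rewrite (lt_le_trans _ r1).
  rewrite (bigD1 k)//= mxE !eqxx cabs1 powR1 big1 ?addr0 ?powR1// => i ik.
  by rewrite mxE (negPf ik) andFb mulr0n cabs0 powR0// gt_eqF.
- move=> _; apply: bigmax_le => // i _; rewrite mxE eqxx andbT.
  by case: (i == k); rewrite ?mulr1n ?mulr0n ?cabs1 ?cabs0.
Qed.

(** Finiteness of the supremum in the induced norm comes from this bound. *)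
Lemma pnorm_le_sum n (x : 'cV[R[i]]_n) : pnorm p x <= \sum_k cabs (x k 0).
Proof.
have {1}-> : x = \sum_k x k 0 *: (delta_mx k 0 : 'cV[R[i]]_n).
  rewrite {1}[x]matrix_sum_delta; apply: eq_bigr => k _.
  by rewrite big_ord1.
rewrite (le_trans (pnorm_sum _ _ _))//; apply: ler_sum => k _.
by rewrite pnormZ -{2}[cabs _]mulr1 ler_wpM2l ?cabs_ge0 ?pnorm_delta.
Qed.

End VectorNorm.

Lemma cvg_sumr (R : realType) (T : Type) (F : set_system T) {FF : Filter F}
    (I : Type) (r : seq I) (f : I -> T -> R) (l : I -> R) :
  (forall i, f i x @[x --> F] --> l i) ->
  \sum_(i <- r) f i x @[x --> F] --> \sum_(i <- r) l i.
Proof.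
move=> fl; elim: r => [|i r IH].
  by rewrite big_nil; under eq_fun do rewrite big_nil; exact: cvg_cst.
by rewrite big_cons; under eq_fun do rewrite big_cons; exact: cvgD.
Qed.

Section InducedNorm.
Variables (R : realType) (p : \bar R).
Hypothesis p1 : (1 <= p)%E.
Implicit Types m n : nat.

Lemma opnorm_le m n (M : 'M[R[i]]_(m, n)) (c : R) : 0 <= c ->
  (forall x : 'cV[R[i]]_n, pnorm p x = 1 -> pnorm p (M *m x) <= c) ->
  opnorm p M <= c.
Proof.
move=> c0 Mc; rewrite /opnorm; set S := image _ _.
have [->|/set0P S0] := eqVneq S set0; first by rewrite sup0.
by apply: ge_sup => // _ [x /= x1 <-]; exact: Mc.
Qed.

Lemma pnorm_mulmx_le_sum m n (M : 'M[R[i]]_(m, n)) (x : 'cV[R[i]]_n) :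
  pnorm p x = 1 -> pnorm p (M *m x) <= \sum_i \sum_j cabs (M i j).
Proof.
move=> x1; rewrite (le_trans (pnorm_le_sum p1 _))//; apply: ler_sum => i _.
rewrite mxE (le_trans (cabs_sum _ _ _))//; apply: ler_sum => j _.
by rewrite cabsM -{2}[cabs (M i j)]mulr1 ler_wpM2l ?cabs_ge0// -x1 cabs_le_pnorm.
Qed.

Lemma pnorm_mulmx_le_opnorm m n (M : 'M[R[i]]_(m, n)) (x : 'cV[R[i]]_n) :
  pnorm p x = 1 -> pnorm p (M *m x) <= opnorm p M.
Proof.
move=> x1; apply: ub_le_sup; last by exists x.
exists (\sum_i \sum_j cabs (M i j)) => _ [y /= y1 <-].
exact: pnorm_mulmx_le_sum.
Qed.

Lemma opnorm_ge0 m n (M : 'M[R[i]]_(m, n)) : 0 <= opnorm p M.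
Proof.
have [/set0P[_ [x /= x1 _]]|] := boolP
  ([set pnorm p (M *m x) | x in [set x : 'cV[R[i]]_n | pnorm p x = 1]] != set0).
  exact: le_trans (pnorm_ge0 _ _) (pnorm_mulmx_le_opnorm _ x1).
by rewrite negbK /opnorm => /eqP ->; rewrite sup0.
Qed.

Lemma opnorm_le_sum m n (M : 'M[R[i]]_(m, n)) :
  opnorm p M <= \sum_i \sum_j cabs (M i j).
Proof.
apply: opnorm_le => [|x x1]; last exact: pnorm_mulmx_le_sum.
by do 2 (apply: sumr_ge0 => ? _); exact: cabs_ge0.
Qed.

Lemma opnorm0 m n : opnorm p (0 : 'M[R[i]]_(m, n)) = 0.
Proof.
apply/eqP; rewrite eq_le opnorm_ge0 andbT (le_trans (opnorm_le_sum _))//.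
by rewrite big1// => i _; rewrite big1// => j _; rewrite mxE cabs0.
Qed.

Lemma opnormD m n (M M' : 'M[R[i]]_(m, n)) :
  opnorm p (M + M') <= opnorm p M + opnorm p M'.
Proof.
apply: opnorm_le => [|x x1]; first by rewrite addr_ge0 ?opnorm_ge0.
by rewrite mulmxDl (le_trans (pnormD p1 _ _))// lerD// pnorm_mulmx_le_opnorm.
Qed.

Lemma opnormZ_le m n a (M : 'M[R[i]]_(m, n)) :
  opnorm p (a *: M) <= cabs a * opnorm p M.
Proof.
apply: opnorm_le => [|x x1]; first by rewrite mulr_ge0 ?cabs_ge0 ?opnorm_ge0.
by rewrite -scalemxAl pnormZ// ler_wpM2l ?cabs_ge0// pnorm_mulmx_le_opnorm.
Qed.

Lemma opnorm_sum m n (I : Type) (r : seq I) (P : pred I)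
    (F : I -> 'M[R[i]]_(m, n)) :
  opnorm p (\sum_(i <- r | P i) F i) <= \sum_(i <- r | P i) opnorm p (F i).
Proof.
elim/big_ind2 : _ => [|x1 x2 y1 y2 h1 h2|//]; first by rewrite opnorm0.
by rewrite (le_trans (opnormD _ _))// lerD.
Qed.

Lemma opnorm_lipschitz m n (M M' : 'M[R[i]]_(m, n)) :
  `|opnorm p M - opnorm p M'| <= \sum_i \sum_j cabs (M i j - M' i j).
Proof.
have half (N N' : 'M[R[i]]_(m, n)) :
    opnorm p N - opnorm p N' <= \sum_i \sum_j cabs (N i j - N' i j).
  rewrite lerBlDl; apply: (@le_trans _ _ (opnorm p N' + opnorm p (N - N'))).
    by rewrite (le_trans _ (opnormD _ _))// subrKC.
  rewrite lerD2l (le_trans (opnorm_le_sum _))//.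
  by apply: ler_sum => i _; apply: ler_sum => j _; rewrite !mxE.
rewrite ler_norml half andbT lerNl opprB (le_trans (half _ _))//.
by apply: ler_sum => i _; apply: ler_sum => j _; rewrite cabsB.
Qed.

(** Entrywise convergence is all that is ever needed to pass to the limit in
    the induced norm. *)
Lemma opnorm_cvg m n (T : Type) (F : set_system T) {FF : Filter F}
    (f : T -> 'M[R[i]]_(m, n)) (M : 'M[R[i]]_(m, n)) :
  (forall i j, cabs (f x i j - M i j) @[x --> F] --> 0) ->
  opnorm p (f x) @[x --> F] --> opnorm p M.
Proof.
move=> fM.
have sum0 : \sum_i \sum_j cabs (f x i j - M i j) @[x --> F] --> (0 : R).
  have z0 : \sum_(i < m) \sum_(j < n) (0 : R) = 0.
    by rewrite big1// => i _; rewrite big1.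
  rewrite -[X in _ --> X]z0.
  apply: (cvg_sumr (f := fun i x => \sum_j cabs (f x i j - M i j))) => i.
  exact: (cvg_sumr (f := fun j x => cabs (f x i j - M i j))).
apply/cvgrPdist_le => e e0.
move/cvgrPdist_le : sum0 => /(_ e e0); apply: filterS => x.
rewrite sub0r normrN => /(le_trans (ler_norm _)) h.
by rewrite distrC (le_trans (opnorm_lipschitz _ _)).
Qed.

End InducedNorm.

(** * Resolvents between a row and a column *)

Lemma poly_eq_horner (K : numFieldType) (p q : {poly K}) :
  (forall s, p.[s] = q.[s]) -> p = q.
Proof.
move=> pq; apply/eqP; rewrite -subr_eq0; apply/negPn/negP => r0.
pose rs : seq K := [seq i%:R | i <- iota 0 (size (p - q))].
have rs_roots : all (root (p - q)) rs.
  by apply/allP => x _; rewrite rootE !hornerE pq subrr.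
have rs_uniq : uniq rs.
  by rewrite map_inj_uniq ?iota_uniq//; exact: mulrIn (oner_neq0 K).
by have := max_poly_roots r0 rs_roots rs_uniq; rewrite size_map size_iota ltnn.
Qed.

Section Realization.
Variables (K : numFieldType) (N' : nat).
Local Notation N := N'.+1.
Variable A : 'M[K]_N.
Implicit Types (p : {poly K}) (s : K) (c : 'rV[K]_N) (b : 'cV[K]_N).

Lemma horner_mx_exprC p k : A ^+ k *m horner_mx A p = horner_mx A p *m A ^+ k.
Proof.
have -> : A ^+ k = horner_mx A 'X^k by rewrite rmorphXn/= horner_mx_X.
have := rmorphM (horner_mx A) p 'X^k.
by rewrite mulrC rmorphM.
Qed.

(** The quotient of [p(s) - p(A)] by [s - A]. *)
Definition quot_mx p s : 'M[K]_N :=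
  \sum_(i < size p) p`_i *: \sum_(l < i) s ^+ (i.-1 - l) *: A ^+ l.

(** The same quotient between [c] and [b], as a polynomial in [s]. *)
Definition quot_poly p c b : {poly K} :=
  \sum_(i < size p) p`_i *: \sum_(l < i) (c *m A ^+ l *m b) 0 0 *: 'X^(i.-1 - l).

Lemma mul_quot_mx p s : (s%:M - A) *m quot_mx p s = p.[s]%:M - horner_mx A p.
Proof.
rewrite /quot_mx mulmx_sumr.
have -> : horner_mx A p = \sum_(i < size p) p`_i *: A ^+ i.
  rewrite -{1}[p]coefK poly_def linear_sum/=; apply: eq_bigr => i _.
  by rewrite linearZ/= rmorphXn/= horner_mx_X.
rewrite horner_coef rmorph_sum/= -sumrB; apply: eq_bigr => i _.
have cA : GRing.comm (s%:M : 'M[K]_N) A by apply: comm_mx_sym; exact: comm_mx_scalar.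
rewrite -(scale_scalar_mx N) (rmorphXn (@scalar_mx K N)).
rewrite -scalerBr -scalemxAr (subrXX_comm _ cA); congr (_ *: _); congr (_ * _).
apply: eq_bigr => l _; rewrite -rmorphXn/=; exact/esym/mul_scalar_mx.
Qed.

Lemma quot_mxC p s : (s%:M - A) *m quot_mx p s = quot_mx p s *m (s%:M - A).
Proof.
have cA : GRing.comm (s%:M - A) A.
  by apply: commr_sym; apply: commrB => //; exact: comm_mx_scalar.
rewrite -[LHS]/((s%:M - A) * quot_mx p s) -[RHS]/(quot_mx p s * (s%:M - A)).
suff : GRing.comm (s%:M - A) (quot_mx p s) by [].
rewrite /quot_mx; apply: commr_sum => i _.
rewrite /GRing.comm -scalerAr -scalerAl; congr (_ *: _).
suff : GRing.comm (s%:M - A) (\sum_(l < i) s ^+ (i.-1 - l) *: A ^+ l) by [].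
apply: commr_sum => l _; rewrite /GRing.comm -scalerAr -scalerAl; congr (_ *: _).
exact: commrX.
Qed.

Lemma horner_quot_poly p c b s :
  (quot_poly p c b).[s] = (c *m quot_mx p s *m b) 0 0.
Proof.
rewrite /quot_poly /quot_mx mulmx_sumr mulmx_suml summxE horner_sum.
apply: eq_bigr => i _; rewrite hornerZ -scalemxAr -scalemxAl [RHS]mxE; congr (_ * _).
rewrite mulmx_sumr mulmx_suml summxE horner_sum; apply: eq_bigr => l _.
by rewrite hornerZ hornerXn -scalemxAr -scalemxAl [RHS]mxE mulrC.
Qed.

Lemma size_quot_poly p c b : p != 0 -> (size (quot_poly p c b) < size p)%N.
Proof.
move=> p0; have sp : (0 < size p)%N by rewrite size_poly_gt0.
rewrite -(prednK sp) ltnS; apply: (leq_trans (size_sum _ _ _)).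
apply/bigmax_leqP => i _; apply: (leq_trans (size_scale_leq _ _)).
apply: (leq_trans (size_sum _ _ _)); apply/bigmax_leqP => l _.
apply: (leq_trans (size_scale_leq _ _)); rewrite size_polyXn.
have := ltn_ord i; have := ltn_ord l; lia.
Qed.

Local Notation chi := (char_poly A).

Lemma mul_quot_char_poly s : (s%:M - A) *m quot_mx chi s = chi.[s]%:M.
Proof. by rewrite mul_quot_mx Cayley_Hamilton subr0. Qed.

Lemma char_poly_neq0 : chi != 0.
Proof. exact: monic_neq0 (char_poly_monic A). Qed.

(** If [c (s - A)^-1 b] vanishes identically, so does [c A (s - A)^-1 b] plus
    the constant [c b]; the former tends to 0 at infinity, hence both vanish.
    The comparison of sizes replaces the limit. *)
Lemma quot_char_poly_shift c b :
  (forall s, c *m quot_mx chi s *m b = 0) ->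
  c *m b = 0 /\ forall s, c *m A *m quot_mx chi s *m b = 0.
Proof.
move=> c0.
have cA s : c *m A *m quot_mx chi s *m b = - chi.[s] *: (c *m b).
  have -> : c *m A = s *: c - c *m (s%:M - A).
    by rewrite mulmxBr mul_mx_scalar opprB addrC subrK.
  rewrite mulmxBl mulmxBl -!scalemxAl c0 scaler0 sub0r.
  by rewrite -(mulmxA c) mul_quot_char_poly mul_mx_scalar -scalemxAl scaleNr.
suff cb0 : c *m b = 0 by split=> // s; rewrite cA cb0 scaler0.
apply/matrixP => i j; rewrite !ord1 [RHS]mxE; apply/eqP/negPn/negP => cb0.
have : quot_poly chi (c *m A) b = - (c *m b) 0 0 *: chi.
  apply: poly_eq_horner => s; rewrite horner_quot_poly cA hornerZ mxE.
  by rewrite !mulNr mulrC.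
move/(congr1 (fun p : {poly K} => size p)); rewrite size_scale ?oppr_eq0//.
move=> sz; have := size_quot_poly (c *m A) b char_poly_neq0.
by rewrite sz ltnn.
Qed.

Lemma quot_char_poly_eq0 c b : (forall s, c *m quot_mx chi s *m b = 0) ->
  forall k, c *m A ^+ k *m b = 0.
Proof.
move=> c0 k.
suff : forall s, c *m A ^+ k *m quot_mx chi s *m b = 0.
  by move/quot_char_poly_shift => [].
elim: k => [|k IH]; first by rewrite mulmx1.
by rewrite exprSr mulmxA; case: (quot_char_poly_shift IH).
Qed.

(** A fraction [n / d] equal to [c (s - A)^-1 b] need not involve all
    eigenvalues of [A]. This makes [d(A)] invisible between [c] and [b], and
    turns the resolvent into a polynomial in [A] divided by [d(s)], which makes
    sense at every [s] that is not a root of [d]. *)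
Lemma resolvent_fraction c b (n d : {poly K}) : d != 0 ->
  (forall s, chi.[s] != 0 ->
     n.[s] * chi.[s] = d.[s] * (c *m quot_mx chi s *m b) 0 0) ->
  (forall k, c *m A ^+ k *m horner_mx A d *m b = 0) /\
  (forall s, n.[s] = (c *m quot_mx d s *m b) 0 0).
Proof.
move=> d0 nd; set c' := c *m horner_mx A d.
have quotM s : chi.[s] *: quot_mx d s =
    d.[s] *: quot_mx chi s - horner_mx A d *m quot_mx chi s.
  rewrite -(mul_scalar_mx d.[s]) -mulmxBl -mul_quot_mx quot_mxC -mulmxA.
  by rewrite mul_quot_char_poly mul_mx_scalar.
(* [chi] times the difference of the two candidate numerators is minus a
   polynomial of smaller size than [chi], so both are zero. *)
have P0 : chi * (quot_poly d c b - n) + quot_poly chi c' b = 0.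
  suff : chi * (chi * (quot_poly d c b - n) + quot_poly chi c' b) = 0.
    by move/eqP; rewrite mulf_eq0 (negPf char_poly_neq0) => /eqP.
  apply: poly_eq_horner => s; rewrite !hornerE.
  have [->|chis] := eqVneq chi.[s] 0; first by rewrite mul0r.
  apply/eqP; rewrite mulf_eq0 (negPf chis) /=; apply/eqP.
  rewrite !horner_quot_poly mulrBr (mulrC _ n.[s]) nd//.
  have -> : chi.[s] * (c *m quot_mx d s *m b) 0 0 =
            (c *m (chi.[s] *: quot_mx d s) *m b) 0 0.
    by rewrite -scalemxAr -scalemxAl [RHS]mxE.
  have -> : c *m (chi.[s] *: quot_mx d s) *m b =
      d.[s] *: (c *m quot_mx chi s *m b) - c' *m quot_mx chi s *m b.
    by rewrite quotM mulmxBr mulmxBl -scalemxAr -scalemxAl !mulmxA.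
  by move: (c *m _ *m b) (c' *m _ *m b) => X Y; rewrite !mxE; ring.
have nE : quot_poly d c b = n.
  apply/eqP; rewrite -subr_eq0; apply/negPn/negP => e0.
  have := size_quot_poly c' b char_poly_neq0.
  move/eqP : P0; rewrite addrC addr_eq0 => /eqP ->.
  rewrite size_polyN size_mul ?char_poly_neq0// -ltnS prednK; last first.
    by rewrite addn_gt0 size_poly_gt0 char_poly_neq0.
  by rewrite ltnS -{2}[size chi]addn0 leq_add2l leqNgt size_poly_gt0 e0.
split=> [k|s]; last by rewrite -horner_quot_poly nE.
rewrite -(mulmxA c) horner_mx_exprC mulmxA -/c'.
apply: quot_char_poly_eq0 => s; apply/matrixP => i j.
rewrite !ord1 -horner_quot_poly mxE.
by move: P0; rewrite nE subrr mulr0 add0r => ->; rewrite horner0.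
Qed.

End Realization.

(** * Entries of the transfer matrix in lowest terms *)

Section LowestTerms.
Variables (F : fieldType) (f : {fraction {poly F}}).

Lemma frac_repr_mul : f * tofrac (frac (repr f)).2 = tofrac (frac (repr f)).1.
Proof.
rewrite -{1}[f]reprK; unlock tofrac; rewrite -[LHS]FracField.pi_mul.
apply/eqmodP; rewrite /= FracField.equivfE /FracField.mulf.
rewrite !numden_Ratio ?(oner_neq0, mulr1, denom_ratioP)//.
by rewrite mulrC.
Qed.

Let g := gcdp (frac (repr f)).1 (frac (repr f)).2.

Let g0 : g != 0.
Proof. by rewrite gcdp_eq0 negb_and denom_ratioP orbT. Qed.

Let ratf_numE : (frac (repr f)).1 = ratf_num f * g.
Proof. by rewrite /ratf_num divpK// dvdp_gcdl. Qed.

Let ratf_denE : (frac (repr f)).2 = ratf_den f * g.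
Proof. by rewrite /ratf_den divpK// dvdp_gcdr. Qed.

Lemma ratf_den_neq0 : ratf_den f != 0.
Proof.
by have := denom_ratioP (repr f); rewrite ratf_denE mulf_eq0 negb_or => /andP[].
Qed.

Lemma mul_ratf_den : f * tofrac (ratf_den f) = tofrac (ratf_num f).
Proof.
have := frac_repr_mul; rewrite ratf_numE ratf_denE !tofracM mulrA.
by apply: mulIf; rewrite tofrac_eq0.
Qed.

End LowestTerms.

Section TransferEntry.
Variables (R : realType) (N' P Q : nat).
Local Notation N := N'.+1.
Variables (A : 'M[R]_N) (B : 'M[R]_(N, P)) (C : 'M[R]_(Q, N)).

Lemma map_ratf_cst (m n : nat) (M : 'M[R]_(m, n)) :
  map_mx (@ratf_cst R) M = map_mx (@tofrac _) (map_mx (@polyC _) (cplxmx M)).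
Proof. by apply/matrixP => i j; rewrite !mxE. Qed.

Let chi := char_poly (cplxmx A).

Lemma transfer_adj i j : tofrac chi * transfer A B C i j =
  tofrac ((map_mx (@polyC _) (row i (cplxmx C)) *m \adj (char_poly_mx (cplxmx A))
    *m map_mx (@polyC _) (col j (cplxmx B))) 0 0).
Proof.
rewrite /transfer !map_ratf_cst.
have -> : (tofrac 'X)%:M - map_mx (@tofrac _) (map_mx (@polyC _) (cplxmx A)) =
    map_mx (@tofrac _) (char_poly_mx (cplxmx A)).
  by rewrite /char_poly_mx map_mxB map_scalar_mx.
set X := map_mx (@tofrac _) (char_poly_mx _).
have detX : \det X = tofrac chi by rewrite det_map_mx.
have chi0 : tofrac chi != 0 by rewrite tofrac_eq0 char_poly_neq0.
have uX : X \in unitmx by rewrite unitmxE detX unitfE.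
have -> : invmx X = (tofrac chi)^-1 *: \adj X by rewrite /invmx uX detX.
rewrite -scalemxAr -scalemxAl [X in _ * X = _]mxE mulrA (mulfV chi0) mul1r.
rewrite -map_mx_adj -!map_mxM mxE; congr tofrac.
rewrite !mxE; apply: eq_bigr => k _; rewrite !mxE; congr (_ * _).
by apply: eq_bigr => l _; rewrite !mxE.
Qed.

(** Specialization of [resolvent_fraction] to an entry of the transfer matrix:
    it only depends on the fraction, not on how it is represented. *)
Lemma transfer_entry i j (f := transfer A B C i j)
    (c := row i (cplxmx C)) (b := col j (cplxmx B)) :
  (forall k, c *m cplxmx A ^+ k *m horner_mx (cplxmx A) (ratf_den f) *m b = 0) /\
  (forall s, (ratf_num f).[s] = (c *m quot_mx (cplxmx A) (ratf_den f) s *m b) 0 0).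
Proof.
apply: resolvent_fraction (ratf_den_neq0 f) _ => s chis.
set G := (map_mx (@polyC _) c *m \adj (char_poly_mx (cplxmx A))
  *m map_mx (@polyC _) b) 0 0.
have /eqP : tofrac (ratf_num f * chi) = tofrac (ratf_den f * G).
  by rewrite !tofracM -mul_ratf_den -mulrA mulrC -mulrA transfer_adj.
rewrite tofrac_eq => /eqP /(congr1 (horner^~ s)).
rewrite !hornerM => ->; congr (_ * _).
have horner_const (m n : nat) (M : 'M[R[i]]_(m, n)) :
    map_mx (horner_eval s) (map_mx (@polyC _) M) = M.
  by apply/matrixP => k l; rewrite !mxE /horner_eval hornerC.
have -> : G.[s] = (map_mx (horner_eval s)
    (map_mx (@polyC _) c *m \adj (char_poly_mx (cplxmx A)) *m map_mx (@polyC _) b)) 0 0.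
  by rewrite [RHS]mxE.
rewrite !map_mxM !horner_const map_mx_adj.
have resE : map_mx (horner_eval s) (char_poly_mx (cplxmx A)) = s%:M - cplxmx A.
  rewrite /char_poly_mx map_mxB map_scalar_mx horner_const /=.
  by rewrite /horner_eval hornerX.
rewrite resE.
suff -> : \adj (s%:M - cplxmx A) = quot_mx (cplxmx A) (char_poly (cplxmx A)) s by [].
apply: (scalerI chis); rewrite -!mul_mx_scalar -{1}mul_quot_char_poly.
rewrite mulmxA mul_adj_mx mul_scalar_mx mul_mx_scalar; congr (_ *: _).
by rewrite -resE det_map_mx.
Qed.

End TransferEntry.

(** * Geometric decay of the Euler iterates *)

Definition euler_mx (R : realType) (N' : nat) (A : 'M[R[i]]_N'.+1) (h : R) :
  'M[R[i]]_N'.+1 := 1%:M + h%:C *: A.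

Lemma root_poly_normal (F : closedFieldType) (d : {poly F}) (rs : seq F) z :
  d != 0 -> d = lead_coef d *: \prod_(z <- rs) ('X - z%:P) ->
  root d z = (z \in rs).
Proof. by move=> d0 ->; rewrite rootZ ?lead_coef_eq0// root_prod_XsubC. Qed.

Section Decay.
Variable R : realType.
Implicit Types (z w : R[i]) (d : {poly R[i]}) (h : R).

Definition geometric_decay (a : nat -> R[i]) :=
  exists c rho : R, [/\ 0 <= rho, rho < 1 & forall k, cabs (a k) <= c * rho ^+ k].

(** A first-order recurrence with a contracting factor keeps the geometric decay
    of its source, at any rate strictly between [max |mu| rho] and 1; the
    midpoint is chosen. *)
Lemma geometric_decay_rec (a b : nat -> R[i]) mu : cabs mu < 1 ->
  (forall k, a k.+1 = mu * a k + b k) -> geometric_decay b -> geometric_decay a.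
Proof.
move=> mu1 ab [c [rho [rho0 rho1 bc]]].
have m0 := cabs_ge0 mu; move: (cabs mu) (cabsM mu) m0 mu1 => m cabsmu m0 m1.
pose r := (1 + Num.max m rho) / 2.
have mr : m <= Num.max m rho by rewrite le_max lexx.
have rhor : rho <= Num.max m rho by rewrite le_max lexx orbT.
have max1 : Num.max m rho < 1 by rewrite gt_max m1 rho1.
have r1 : r < 1 by rewrite /r; lra.
have mltr : m < r by rewrite /r; lra.
have rhole : rho <= r by rewrite /r; lra.
have c0 : 0 <= c by have := bc 0%N; rewrite mulr1; apply: le_trans; exact: cabs_ge0.
have r0 : 0 <= r by rewrite (le_trans m0)// ltW.
have rm0 : 0 < r - m by rewrite subr_gt0.
exists (cabs (a 0%N) + c / (r - m)), r; split=> //; elim=> [|k IH].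
  by rewrite mulr1 lerDl divr_ge0// ltW.
rewrite ab (le_trans (cabsD _ _))// cabsmu.
set c' := _ + _ in IH *.
have cc' : c <= c' * (r - m).
  by rewrite /c' mulrDl divfK ?gt_eqF// lerDr mulr_ge0 ?cabs_ge0// ltW.
apply: (@le_trans _ _ (m * (c' * r ^+ k) + c * r ^+ k)).
  apply: lerD; first exact: ler_wpM2l.
  by rewrite (le_trans (bc k))// ler_wpM2l// lerXn2r// nnegrE.
rewrite mulrA -mulrDl exprS mulrA ler_wpM2r ?exprn_ge0//.
by move: cc'; rewrite mulrBr lerBrDr [m * _]mulrC addrC.
Qed.

Lemma geometric_decay_cvg0 a : geometric_decay a -> cabs (a k) @[k --> \oo] --> 0.
Proof.
move=> [c [rho [rho0 rho1 ac]]].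
apply: (@squeeze_cvgr _ _ _ _ (fun=> 0) (fun k => c * rho ^+ k)).
- by near=> k; rewrite cabs_ge0 ac.
- exact: cvg_cst.
- rewrite -[X in _ --> X](mulr0 c); apply: cvgM; first exact: cvg_cst.
  by apply: cvg_expr; rewrite ger0_norm.
Unshelve. all: by end_near. Qed.

Variables (N' : nat) (A : 'M[R[i]]_N'.+1) (c : 'rV[R[i]]_N'.+1).
Local Notation G h := (euler_mx A h).

Lemma krylov_eq0 h (v : 'cV[R[i]]_N'.+1) : (forall k, c *m A ^+ k *m v = 0) ->
  forall k, c *m G h ^+ k *m v = 0.
Proof.
move=> v0 k; elim: k v v0 => [|k IH] v v0; first exact: (v0 0%N).
rewrite exprSr -[G h ^+ k * G h]/(G h ^+ k *m G h) -!mulmxA mulmxA.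
apply: IH => m; rewrite /euler_mx mulmxDl mul1mx -scalemxAl mulmxDr v0 add0r -scalemxAr.
have := v0 m.+1; rewrite exprSr -[A ^+ m * A]/(A ^+ m *m A) -!mulmxA => ->.
by rewrite scaler0.
Qed.

(** Induction on the annihilating roots. Replacing [v] by [(A - z) v] removes the
    root [z], and [G - (1 + h z) = h (A - z)] turns this into a recurrence of
    factor [1 + h z] for the sequence [c G^k v]. *)
Lemma decay_krylov h (rs : seq R[i]) (v : 'cV[R[i]]_N'.+1) :
  (forall z, z \in rs -> cabs (1 + h%:C * z) < 1) ->
  (forall k, c *m A ^+ k *m horner_mx A (\prod_(z <- rs) ('X - z%:P)) *m v = 0) ->
  geometric_decay (fun k => (c *m G h ^+ k *m v) 0 0).
Proof.
elim: rs v => [|z rs IH] v zs v0.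
  exists 0, 0; split=> // k; rewrite mul0r krylov_eq0 ?mxE ?cabs0// => m.
  by have := v0 m; rewrite big_nil rmorph1 mulmx1.
have dec : geometric_decay (fun k => (c *m G h ^+ k *m ((A - z%:M) *m v)) 0 0).
  apply: IH => [y ys|k]; first by apply: zs; rewrite in_cons ys orbT.
  have := v0 k; rewrite big_cons mulrC rmorphM rmorphB/= horner_mx_X horner_mx_C.
  by rewrite !mulmxA.
apply: (geometric_decay_rec (mu := 1 + h%:C * z)
  (b := fun k => h%:C * (c *m G h ^+ k *m ((A - z%:M) *m v)) 0 0)).
- by apply: zs; rewrite mem_head.
- move=> k.
  have -> : c *m G h ^+ k.+1 *m v = (1 + h%:C * z) *: (c *m G h ^+ k *m v)
      + h%:C *: (c *m G h ^+ k *m ((A - z%:M) *m v)).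
    rewrite exprSr -[G h ^+ k * G h]/(G h ^+ k *m G h) mulmxA -(mulmxA _ (G h) v).
    rewrite 2![_ *: (_ *m G h ^+ k *m _)]scalemxAr -mulmxDr; congr (_ *m _).
    rewrite /euler_mx mulmxDl mul1mx mulmxBl mul_scalar_mx scalerBr scalerA scalerDl scale1r.
    by rewrite -scalemxAl addrACA -addrA subrr !addr0 addrC.
  by rewrite mxE [X in X + _ = _]mxE [X in _ + X = _]mxE.
- case: dec => C [rho [rho0 rho1 le]]; exists (`|h| * C), rho; split=> // k.
  by rewrite cabsM cabs_real -mulrA ler_wpM2l.
Qed.

End Decay.

(** * The generating function of the Euler iterates *)

Section EulerResolvent.
Variables (R : realType) (N' : nat) (A : 'M[R[i]]_N'.+1).
Variables (c : 'rV[R[i]]_N'.+1) (b : 'cV[R[i]]_N'.+1) (n d : {poly R[i]}).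
Hypothesis annih : forall k, c *m A ^+ k *m horner_mx A d *m b = 0.
Hypothesis numE : forall s, n.[s] = (c *m quot_mx A d s *m b) 0 0.

(** The generating function of the Euler iterates [c (1 + hA)^m b], truncated
    at [m = k], in terms of the transfer function at [s = (w - 1) / h]. *)
Lemma euler_generating (h : R) (w : R[i]) k (s := (w - 1) / h%:C) :
  h != 0 -> d.[s] != 0 ->
  h%:C * \sum_(m < k) w ^+ (k.-1 - m) * (c *m euler_mx A h ^+ m *m b) 0 0 =
  w ^+ k * (n.[s] / d.[s]) -
    (c *m euler_mx A h ^+ k *m (quot_mx A d s *m b)) 0 0 / d.[s].
Proof.
move=> h0 ds0; have hC0 : h%:C != 0 by rewrite fmorph_eq0.
rewrite [w ^+ k * (_ / _)]mulrA -mulrBl; apply: (mulIf ds0); rewrite divfK//.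
set G := euler_mx A h; set q := quot_mx A d s *m b.
have comm_wG : GRing.comm (w%:M : 'M[R[i]]_N'.+1) G.
  by apply: comm_mx_sym; exact: comm_mx_scalar.
have wGE : w%:M - G = h%:C *: (s%:M - A).
  rewrite scalerBr scale_scalar_mx /s mulrC divfK// /G /euler_mx.
  by rewrite opprD addrA -rmorphB.
have GA m : c *m G ^+ m *m (horner_mx A d *m b) = 0.
  by apply: krylov_eq0 => k'; rewrite mulmxA annih.
have key : (w%:M ^+ k - G ^+ k) *m q =
   h%:C *: \sum_(m < k) w ^+ (k.-1 - m) *: (G ^+ m *m ((d.[s]%:M - horner_mx A d) *m b)).
  have -> : w%:M ^+ k - G ^+ k =
      (\sum_(m < k) w%:M ^+ (k.-1 - m) * G ^+ m) *m (w%:M - G).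
    rewrite (subrXX_comm k comm_wG).
    suff : GRing.comm (w%:M - G) (\sum_(m < k) w%:M ^+ (k.-1 - m) * G ^+ m) by [].
    apply: commr_sum => m _; apply: commrM; apply: commrX.
      by apply: commr_sym; exact: commrB.
    by apply: commr_sym; apply: commrB => //; exact: commr_sym.
  rewrite -mulmxA wGE -scalemxAl /q (mulmxA (s%:M - A)) mul_quot_mx -scalemxAr.
  congr (_ *: _); rewrite mulmx_suml; apply: eq_bigr => m _.
  rewrite -(rmorphXn (@scalar_mx _ N'.+1)) /= -[_ * G ^+ m]/(_ *m G ^+ m).
  by rewrite mul_scalar_mx -scalemxAl.
have -> : w ^+ k * n.[s] = (c *m (w%:M ^+ k *m q)) 0 0.
  rewrite -(rmorphXn (@scalar_mx _ N'.+1)) /= mul_scalar_mx -scalemxAr mxE.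
  by rewrite numE mulmxA.
have -> : c *m G ^+ k *m q = c *m (G ^+ k *m q) by rewrite mulmxA.
transitivity ((c *m ((w%:M ^+ k - G ^+ k) *m q)) 0 0); last first.
  by rewrite mulmxBl mulmxBr [LHS]mxE [X in _ + X = _]mxE.
rewrite key -scalemxAr [RHS]mxE -mulrA; congr (_ * _).
rewrite mulmx_sumr summxE mulr_suml; apply: eq_bigr => m _.
rewrite -scalemxAr [RHS]mxE -mulrA; congr (_ * _).
rewrite mulmxA mulmxBl mulmxBr GA subr0 mul_scalar_mx -scalemxAr [RHS]mxE.
by rewrite mulrC.
Qed.

End EulerResolvent.

Section PolynomialBounds.
Variable R : realType.
Implicit Types (d : {poly R[i]}).

Lemma poly_lower_bound d (S : set R[i]) (e : R) : d != 0 -> 0 < e ->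
  (forall z s, root d z -> S s -> e <= cabs (s - z)) ->
  exists2 delta : R, 0 < delta & forall s, S s -> delta <= cabs d.[s].
Proof.
move=> d0 e0 dz; have [rs dE] := closed_field_poly_normal d.
have zs z : z \in rs -> root d z.
  by rewrite (root_poly_normal _ d0 dE).
exists (cabs (lead_coef d) * e ^+ size rs).
  by rewrite mulr_gt0 ?exprn_gt0// cabs_gt0 lead_coef_eq0.
move=> s Ss; rewrite {2}dE hornerZ cabsM ler_wpM2l ?cabs_ge0//.
elim: rs zs {dE} => [|z rs IH] zs; first by rewrite big_nil hornerC cabs1.
rewrite big_cons hornerM cabsM exprS ler_pM ?exprn_ge0//.
- exact: ltW.
- exact: ltW.
- by rewrite hornerXsubC dz// zs// mem_head.
- by apply: IH => y ys; rewrite zs// in_cons ys orbT.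
Qed.

Lemma poly_upper_bound d (s : R[i]) (r : R) : cabs s <= r ->
  cabs d.[s] <= \sum_(i < size d) cabs d`_i * r ^+ i.
Proof.
move=> sr; rewrite horner_coef (le_trans (cabs_sum _ _ _))//.
apply: ler_sum => i _; rewrite cabsM cabsX ler_wpM2l ?cabs_ge0//.
by rewrite lerXn2r// nnegrE ?(le_trans _ sr) ?cabs_ge0.
Qed.

Lemma seq_Re_bound (rs : seq R[i]) : (forall z, z \in rs -> complex.Re z < 0) ->
  exists delta rho : R, [/\ 0 < delta, 0 < rho &
    forall z, z \in rs -> complex.Re z <= - delta /\ cabs z <= rho].
Proof.
elim: rs => [|z rs IH] zs; first by exists 1, 1; split.
have [y ys|delta [rho [delta0 rho0 b]]] := IH.
  by apply: zs; rewrite in_cons ys orbT.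
have z0 : complex.Re z < 0 by apply: zs; rewrite mem_head.
exists (Num.min delta (- complex.Re z)), (Num.max rho (cabs z)); split.
- by rewrite lt_min delta0 oppr_gt0.
- by rewrite lt_max rho0.
- move=> y; rewrite in_cons => /orP[/eqP ->|/b[y1 y2]].
    by rewrite le_max lexx orbT lerNr ge_min lexx orbT.
  by rewrite le_max y2 lerNr ge_min lerNr y1.
Qed.

End PolynomialBounds.

(** There are finitely many poles, so they stay away from the imaginary axis. *)
Lemma io_stable_uniform (R : realType) (N P Q : nat)
    (A : 'M[R]_N) (B : 'M[R]_(N, P)) (C : 'M[R]_(Q, N)) : io_stable A B C ->
  exists delta rho : R, [/\ 0 < delta, 0 < rho &
    forall i j z, ratf_pole (transfer A B C i j) z ->
      complex.Re z <= - delta /\ cabs z <= rho].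
Proof.
move=> st; pose f (ij : 'I_Q * 'I_P) := transfer A B C ij.1 ij.2.
pose rs ij := sval (closed_field_poly_normal (ratf_den (f ij))).
have rsP ij z : (z \in rs ij) = ratf_pole (f ij) z.
  apply/esym; apply: root_poly_normal (ratf_den_neq0 _) _.
  exact: svalP (closed_field_poly_normal (ratf_den (f ij))).
have [|delta [rho [delta0 rho0 b]]] :=
    @seq_Re_bound R (flatten [seq rs ij | ij <- enum {: 'I_Q * 'I_P}]).
  by move=> z /flatten_mapP[ij _]; rewrite rsP => /st.
exists delta, rho; split=> // i j z pz; apply: b; apply/flatten_mapP.
by exists (i, j); rewrite ?mem_enum// rsP.
Qed.

(** * Roots of unity *)

Section UnitCircle.
Variable R : realType.
Implicit Types (t u : R).

Definition cexp t : R[i] := cos t +i* sin t.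

Lemma cexpD t u : cexp (t + u) = cexp t * cexp u.
Proof.
rewrite /cexp cosD sinD; apply/eqP; rewrite eq_complex /= eqxx /=.
by apply/eqP; ring.
Qed.

Lemma cexp0 : cexp 0 = 1.
Proof. by rewrite /cexp cos0 sin0. Qed.

Lemma cexpX t n : cexp t ^+ n = cexp (t *+ n).
Proof.
by elim: n => [|n IH]; rewrite ?cexp0// exprS mulrS cexpD IH.
Qed.

Lemma cabs_cexp t : cabs (cexp t) = 1.
Proof. by rewrite /cabs /= cos2Dsin2 sqrtr1. Qed.

Lemma cexp_neq0 t : cexp t != 0.
Proof. by rewrite -cabs_gt0 cabs_cexp. Qed.

Lemma cos_half t : cos t = 1 - 2 * sin (t / 2) ^+ 2.
Proof.
rewrite {1}[t]splitr cosD -!expr2.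
by have := cos2Dsin2 (t / 2); lra.
Qed.

Lemma cexp_eq1 t : 0 < t < 2 * pi -> cexp t != 1.
Proof.
move=> /andP[t0 t2]; apply/eqP => /(congr1 (@complex.Re R)) /=.
rewrite cos_half; have : 0 < sin (t / 2) by apply: sin_gt0_pi; lra.
by move/(exprn_gt0 2); lra.
Qed.

(** Arguments of the [n]-th roots of [(-1)^n]. Starting from [- pi] rather than 0
    makes the frequencies [angle n l / h] sweep an interval centred at 0. *)
Definition angle n (l : nat) : R := - pi + 2 * pi * l%:R / n%:R.

(** Up to a constant factor, the terms are the powers of [xi = z^(b - a)], an
    [n]-th root of unity other than 1 when [a] and [b] differ. *)
Lemma cexp_angle_orthogonal n a b : (a < n)%N -> (b < n)%N ->
  \sum_(l < n) (cexp (angle n l) ^+ a)^-1 * cexp (angle n l) ^+ b =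
  if a == b then n%:R else 0.
Proof.
move=> an bn; have n0 : (n%:R : R) != 0 by rewrite pnatr_eq0; lia.
have [<-|ab] := eqVneq a b.
  rewrite (eq_bigr (fun=> 1)); last by move=> l _; rewrite mulVf ?expf_neq0 ?cexp_neq0.
  by rewrite sumr_const card_ord.
pose z := cexp (2 * pi / n%:R); pose xi := (z ^+ a)^-1 * z ^+ b.
have z0 : z != 0 := cexp_neq0 _.
have zn : z ^+ n = 1.
  have E : 2 * pi / n%:R *+ n = pi + pi :> R.
    by rewrite -[LHS]mulr_natr divfK//; ring.
  rewrite cexpX E cexpD /cexp cospi sinpi.
  by apply/eqP; rewrite eq_complex /=; apply/andP; split; apply/eqP; ring.
have xin : xi ^+ n = 1.
  by rewrite exprMn exprVn -!exprM ![(_ * n)%N]mulnC !exprM zn !expr1n invr1 mulr1.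
have zneq i : (0 < i < n)%N -> z ^+ i != 1.
  move=> /andP[i0 ilt]; rewrite cexpX; apply: cexp_eq1; apply/andP; split.
    by rewrite pmulrn_lgt0// divr_gt0 ?mulr_gt0 ?pi_gt0// ltr0n; lia.
  rewrite -[ltLHS]mulr_natr mulrAC ltr_pdivrMr ?ltr0n; last lia.
  by rewrite ltr_pM2l ?mulr_gt0 ?pi_gt0// ltr_nat.
have xi1 : xi != 1.
  apply/eqP => /(congr1 ( *%R (z ^+ a))); rewrite mulVKf ?expf_neq0// mulr1.
  have [ltab|ltba|abE] := ltngtP a b; last by rewrite abE eqxx in ab.
    move/eqP; rewrite -(subnKC (ltnW ltab)) exprD -{2}[z ^+ a]mulr1.
    by rewrite (inj_eq (mulfI (expf_neq0 _ z0))) (negPf (zneq _ _))//; lia.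
  move/eqP; rewrite -(subnKC (ltnW ltba)) exprD -{1}[z ^+ b]mulr1.
  by rewrite (inj_eq (mulfI (expf_neq0 _ z0))) eq_sym (negPf (zneq _ _))//; lia.
have term l : (cexp (angle n l) ^+ a)^-1 * cexp (angle n l) ^+ b =
    (cexp (- pi) ^+ a)^-1 * cexp (- pi) ^+ b * xi ^+ l.
  have -> : cexp (angle n l) = cexp (- pi) * z ^+ l.
    by rewrite cexpX -cexpD; congr cexp; rewrite /angle -[X in _ = _ + X]mulr_natr; ring.
  rewrite !exprMn invfM mulrACA; congr (_ * _).
  by rewrite /xi ?exprMn exprVn -!exprM !(mulnC l).
rewrite (eq_bigr _ (fun (l : 'I_n) _ => term l)) -mulr_sumr.
suff -> : \sum_(l < n) xi ^+ l = 0 by rewrite mulr0.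
apply: (mulfI (x := xi - 1)); first by rewrite subr_eq0.
by rewrite -subrX1 xin subrr mulr0.
Qed.

End UnitCircle.

(** * Discrete Fourier inversion *)

(** The point of the [s]-plane that the explicit Euler scheme of step [h]
    substitutes for [i omega]; it lies on the circle of centre [-1/h] through
    the origin. *)
Definition euler_point (R : realType) (h omega : R) : R[i] :=
  (cexp (h * omega) - 1) / h%:C.

Section EulerTail.
Variables (R : realType) (N' : nat) (A : 'M[R[i]]_N'.+1).
Variables (c : 'rV[R[i]]_N'.+1) (b : 'cV[R[i]]_N'.+1) (d : {poly R[i]}).
Hypothesis annih : forall k, c *m A ^+ k *m horner_mx A d *m b = 0.
Hypothesis d0 : d != 0.
Variable h : R.
Hypothesis h0 : 0 < h.
Hypothesis stable : forall z, root d z -> cabs (1 + h%:C * z) < 1.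

Lemma euler_decay l :
  geometric_decay (fun k => (c *m euler_mx A h ^+ k *m (A ^+ l *m b)) 0 0).
Proof.
have [rs dE] := closed_field_poly_normal d.
apply: (decay_krylov (rs := rs)) => [z zs|k].
  by apply: stable; rewrite (root_poly_normal _ d0 dE).
have lc0 : lead_coef d != 0 by rewrite lead_coef_eq0.
apply: (scalerI lc0); rewrite scaler0 scalemxAl scalemxAr -linearZ/= -dE.
rewrite mulmxA -(mulmxA _ (horner_mx A d)) -horner_mx_exprC mulmxA -(mulmxA c).
by rewrite -[A ^+ k *m A ^+ l]/(A ^+ k * A ^+ l) -exprD annih.
Qed.

Lemma euler_circle_lower_bound : exists2 delta : R, 0 < delta &
  forall w, cabs w = 1 -> delta <= cabs d.[(w - 1) / h%:C].
Proof.
have [rs dE] := closed_field_poly_normal d.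
have rsP z : root d z = (z \in rs).
  exact: root_poly_normal d0 dE.
have [e e0 eP] : exists2 e : R, 0 < e &
    forall z, z \in rs -> e <= (1 - cabs (1 + h%:C * z)) / h.
  have : forall z, z \in rs -> cabs (1 + h%:C * z) < 1.
    by move=> z; rewrite -rsP => /stable.
  elim: rs {dE rsP} => [|z rs IH] zs; first by exists 1.
  have [y ys|e e0 eP] := IH; first by apply: zs; rewrite in_cons ys orbT.
  exists (Num.min e ((1 - cabs (1 + h%:C * z)) / h)).
    by rewrite lt_min e0 divr_gt0// subr_gt0 zs ?mem_head.
  move=> y; rewrite in_cons => /orP[/eqP ->|/eP ye]; rewrite ge_min ?lexx ?orbT//.
  by rewrite ye.
have [|delta delta0 dP] := @poly_lower_bound R d
    [set s | exists2 w, cabs w = 1 & s = (w - 1) / h%:C] e d0 e0.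
  move=> z _ rz [w w1 ->]; rewrite (le_trans (eP z _)) -?rsP//.
  have hC0 : h%:C != 0 by rewrite fmorph_eq0 gt_eqF.
  have -> : (w - 1) / h%:C - z = (w - (1 + h%:C * z)) / h%:C by field.
  rewrite cabsM cabsV cabs_real gtr0_norm// ler_wpM2r ?invr_ge0 ?(ltW h0)//.
  rewrite lerBlDr -w1 (le_trans _ (cabsD _ _))//.
  by rewrite subrK.
exists delta => // w w1; apply: dP; by exists w.
Qed.

(** The remainder in [euler_generating]. Multiplied by [d(s)], it is a
    combination of finitely many decaying sequences [c G^n A^l b], with
    coefficients bounded on the unit circle; and [d(s)] is bounded away from
    0 there, because the roots of [d] are inside the Euler circle. *)
Lemma euler_tail (e : R) : 0 < e -> \forall n \near \oo, forall w, cabs w = 1 ->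
  cabs ((c *m euler_mx A h ^+ n *m (quot_mx A d ((w - 1) / h%:C) *m b)) 0 0
    / d.[(w - 1) / h%:C]) <= e.
Proof.
move=> e0; have [delta delta0 dP] := euler_circle_lower_bound.
pose f n := \sum_(i < size d) cabs d`_i * \sum_(l < i) (2 / h) ^+ (i.-1 - l) *
  cabs ((c *m euler_mx A h ^+ n *m (A ^+ l *m b)) 0 0).
have f0 : f n @[n --> \oo] --> 0.
  have z0 : \sum_(i < size d) cabs d`_i * \sum_(l < i) (2 / h) ^+ (i.-1 - l) * 0 = 0.
    by rewrite big1// => i _; rewrite big1 ?mulr0// => l _; rewrite mulr0.
  rewrite -[X in _ --> X]z0 /f.
  apply: (cvg_sumr (f := fun (i : 'I_(size d)) n =>
    cabs d`_i * \sum_(l < i) (2 / h) ^+ (i.-1 - l) *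
    cabs ((c *m euler_mx A h ^+ n *m (A ^+ l *m b)) 0 0))) => i.
  apply: cvgM; first exact: cvg_cst.
  apply: (cvg_sumr (f := fun (l : 'I_i) n => (2 / h) ^+ (i.-1 - l) *
    cabs ((c *m euler_mx A h ^+ n *m (A ^+ l *m b)) 0 0))) => l.
  apply: cvgM; first exact: cvg_cst.
  exact: geometric_decay_cvg0 (euler_decay l).
have fle n w : cabs w = 1 ->
    cabs ((c *m euler_mx A h ^+ n *m (quot_mx A d ((w - 1) / h%:C) *m b)) 0 0) <= f n.
  move=> w1; rewrite /quot_mx mulmx_suml mulmx_sumr summxE.
  rewrite (le_trans (cabs_sum _ _ _))//; apply: ler_sum => i _.
  rewrite -scalemxAl -scalemxAr mxE cabsM ler_wpM2l ?cabs_ge0//.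
  rewrite mulmx_suml mulmx_sumr summxE.
  rewrite (le_trans (cabs_sum _ _ _))//; apply: ler_sum => l _.
  rewrite -scalemxAl -scalemxAr mxE cabsM ler_wpM2r ?cabs_ge0//.
  rewrite cabsX lerXn2r// ?nnegrE ?cabs_ge0 ?divr_ge0 ?(ltW h0)//.
  rewrite cabsM cabsV cabs_real gtr0_norm// ler_wpM2r ?invr_ge0 ?(ltW h0)//.
  by rewrite (le_trans (cabsD _ _))// cabsN w1 cabs1.
move/cvgrPdist_le : f0 => /(_ (e * delta) (mulr_gt0 e0 delta0)).
apply: filterS => n; rewrite sub0r normrN => fn w w1.
rewrite cabsM cabsV ler_pdivrMr; last by rewrite (lt_le_trans delta0)// dP.
rewrite (le_trans (fle _ _ w1))// (le_trans (ler_norm _))// (le_trans fn)//.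
by rewrite ler_wpM2l ?(ltW e0)// dP.
Qed.

End EulerTail.

Section DiscreteFourier.
Variables (R : realType) (N' P Q : nat).
Variables (A : 'M[R]_N'.+1) (B : 'M[R]_(N'.+1, P)) (C : 'M[R]_(Q, N'.+1)).
Local Notation Ac := (cplxmx A).
Local Notation Bc := (cplxmx B).
Local Notation Cc := (cplxmx C).

(** The entrywise remainder in [euler_generating]; the polynomial [d], hence the
    polynomial replacing the resolvent, varies with the entry. *)
Definition euler_err h n w : 'M[R[i]]_(Q, P) := \matrix_(i, j)
  ((row i Cc *m euler_mx Ac h ^+ n *m
     (quot_mx Ac (ratf_den (transfer A B C i j)) ((w - 1) / h%:C) *m col j Bc)) 0 0
    / (ratf_den (transfer A B C i j)).[(w - 1) / h%:C]).

(** Fourier inversion over the points [w l]: orthogonality singles out the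
    iterate of index [k] from the generating function. *)
Lemma euler_dft h n k (w := fun l => cexp (@angle R n l)) : h != 0 -> (k < n)%N ->
  (forall i j w, cabs w = 1 -> ~~ ratf_pole (transfer A B C i j) ((w - 1) / h%:C)) ->
  (n%:R * h)%:C *: (Cc *m euler_mx Ac h ^+ k *m Bc) =
  \sum_(l < n) (w l ^+ (n.-1 - k))^-1 *:
     (w l ^+ n *: transfer_at A B C ((w l - 1) / h%:C) - euler_err h n (w l)).
Proof.
move=> h0 kn nopole; apply/matrixP => i j.
have [annih numE] := transfer_entry A B C i j.
set d := ratf_den _ in annih numE; set b := col j Bc in annih numE.
set c := row i Cc in annih numE.
have entry (M : 'M[R[i]]_N'.+1) : (Cc *m M *m Bc) i j = (c *m M *m b) 0 0.
  rewrite !mxE; apply: eq_bigr => l _; rewrite !mxE; congr (_ * _).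
  by apply: eq_bigr => m _; rewrite !mxE.
rewrite [LHS]mxE entry summxE.
transitivity (\sum_(l < n) (w l ^+ (n.-1 - k))^-1 *
   (h%:C * \sum_(m < n) w l ^+ (n.-1 - m) * (c *m euler_mx Ac h ^+ m *m b) 0 0)).
  have -> : \sum_(l < n) (w l ^+ (n.-1 - k))^-1 *
     (h%:C * \sum_(m < n) w l ^+ (n.-1 - m) * (c *m euler_mx Ac h ^+ m *m b) 0 0) =
   h%:C * \sum_(m < n) (c *m euler_mx Ac h ^+ m *m b) 0 0 *
     \sum_(l < n) (w l ^+ (n.-1 - k))^-1 * w l ^+ (n.-1 - m).
    under [in RHS]eq_bigr do rewrite mulr_sumr.
    rewrite exchange_big mulr_sumr; apply: eq_bigr => l _.
    rewrite mulrCA; congr (_ * _); rewrite mulr_sumr; apply: eq_bigr => m _.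
    by rewrite mulrA mulrC.
  rewrite (bigD1 (Ordinal kn))//= cexp_angle_orthogonal ?eqxx; try lia.
  rewrite big1 ?addr0 => [|m mk].
    by rewrite rmorphM rmorph_nat; ring.
  rewrite cexp_angle_orthogonal; try lia.
  rewrite ifF ?mulr0//; apply/negbTE; move: mk; rewrite -val_eqE /=.
  by have := ltn_ord m; lia.
apply: eq_bigr => l _; rewrite [RHS]mxE; congr (_ * _).
rewrite (euler_generating annih numE)//; last first.
  by have := nopole i j (w l) (cabs_cexp _); rewrite /ratf_pole rootE.
rewrite [RHS]mxE [X in _ = X + _]mxE [X in _ = _ + X]mxE.
by rewrite [transfer_at _ _ _ _ i j]mxE [euler_err _ _ _ i j]mxE.
Qed.

End DiscreteFourier.

Section EulerBound.
Variables (R : realType) (N' P Q : nat).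
Variables (A : 'M[R]_N'.+1) (B : 'M[R]_(N'.+1, P)) (C : 'M[R]_(Q, N'.+1)).
Variables (p : \bar R) (h : R).
Hypothesis p1 : (1 <= p)%E.
Hypothesis h0 : 0 < h.
Hypothesis stable : forall i j z, ratf_pole (transfer A B C i j) z ->
  cabs (1 + h%:C * z) < 1.

Lemma cplxmx_euler k : cplxmx ((1%:M + h *: A) ^+ k) = euler_mx (cplxmx A) h ^+ k.
Proof.
elim: k => [|k IH]; first by rewrite !expr0 /cplxmx map_mx1.
rewrite !exprS -IH /cplxmx -[LHS]/(map_mx _ (_ *m _)) map_mxM /=.
by congr (_ *m _); rewrite map_mxD map_mx1 map_mxZ.
Qed.

(** All the phases in [euler_dft] have modulus 1, so the triangle inequality
    loses nothing but the remainder, and the bound is uniform in [k]. *)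
Lemma euler_opnorm_bound (e : R) : 0 < e -> \forall n \near \oo, forall k, (k < n)%N ->
  opnorm p (cplxmx (C *m (1%:M + h *: A) ^+ k *m B)) <=
  (n%:R * h)^-1 * \sum_(l < n)
     opnorm p (transfer_at A B C (euler_point h (@angle R n l / h))) + e.
Proof.
move=> e0; pose e' := e * h / (Q * P).+1%:R.
have e'0 : 0 < e' by rewrite divr_gt0 ?mulr_gt0 ?ltr0n.
(* [e'] is the share of [e] that each entry of the remainder may take. *)
have tail : \forall n \near \oo, forall (ij : 'I_Q * 'I_P) w, cabs w = 1 ->
    cabs (euler_err A B C h n w ij.1 ij.2) <= e'.
  apply: filter_forall => -[i j]; have [annih _] := transfer_entry A B C i j.
  have st z : root (ratf_den (transfer A B C i j)) z -> cabs (1 + h%:C * z) < 1.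
    exact: stable.
  have := euler_tail annih (ratf_den_neq0 _) h0 st e'0.
  by apply: filterS => n nw w w1; rewrite mxE; exact: nw.
apply: filterS tail => n tail k kn.
have hC0 : h%:C != 0 by rewrite fmorph_eq0 gt_eqF.
have n0 : 0 < n%:R :> R by rewrite ltr0n; lia.
have nh0 : 0 < n%:R * h by rewrite mulr_gt0.
have nopole i j w : cabs w = 1 -> ~~ ratf_pole (transfer A B C i j) ((w - 1) / h%:C).
  move=> w1; apply/negP => /stable.
  by rewrite mulrC divfK// addrC subrK w1 ltxx.
have := euler_dft (lt0r_neq0 h0) kn nopole.
set S := \sum_(l < n) _ => SE.
have -> : cplxmx (C *m (1%:M + h *: A) ^+ k *m B) = ((n%:R * h)^-1)%:C *: S.
  rewrite -SE scalerA -rmorphM mulVf ?gt_eqF// scale1r -cplxmx_euler.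
  by rewrite /cplxmx !map_mxM.
rewrite (le_trans (opnormZ_le p1 _ _))// cabs_real gtr0_norm ?invr_gt0//.
have -> : e = (n%:R * h)^-1 * \sum_(l < n) (e * h).
  by rewrite sumr_const card_ord -mulr_natr; field; rewrite ?gt_eqF.
rewrite -mulrDr ler_wpM2l ?invr_ge0 ?(ltW nh0)// -big_split /=.
rewrite (le_trans (opnorm_sum p1 _ _ _))//; apply: ler_sum => l _.
have cw : cabs (cexp (@angle R n l)) = 1 := cabs_cexp _.
rewrite (le_trans (opnormZ_le p1 _ _))// cabsV cabsX cw expr1n invr1 mul1r.
apply: (le_trans (opnormD p1 _ _)); apply: lerD.
  rewrite (le_trans (opnormZ_le p1 _ _))// cabsX cw expr1n mul1r.
  by rewrite /euler_point (mulrC h) divfK ?gt_eqF.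
rewrite -scaleN1r (le_trans (opnormZ_le p1 _ _))// cabsN cabs1 mul1r.
rewrite (le_trans (opnorm_le_sum p1 _))//.
apply: (@le_trans _ _ (\sum_(i < Q) \sum_(j < P) e')).
  by apply: ler_sum => i _; apply: ler_sum => j _; exact: (tail (i, j)).
rewrite !sumr_const !card_ord -mulrnA -mulr_natr /e' -mulrA ger_pMr ?mulr_gt0//.
by rewrite mulrC ler_pdivrMr ?ltr0n// mul1r ler_nat mulnC leqnSn.
Qed.

End EulerBound.

(** * Geometry of the Euler circle *)

Section EulerCircle.
Variable R : realType.
Implicit Types (x t h omega : R).

Lemma ler_norm_sin x : `|sin x| <= `|x|.
Proof.
wlog x0 : x / 0 < x.
  move=> H; have [x0|x0|->] := ltgtP x 0; last by rewrite sin0 normr0.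
    by rewrite -normrN -sinN -(normrN x) H// oppr_gt0.
  exact: H.
have [|c _] := @MVT R sin cos 0 x x0.
  by apply: continuous_subspaceT => y; exact: continuous_sin.
by rewrite sin0 !subr0 => ->; rewrite normrM ler_piMl// ler_norml cos_geN1 cos_le1.
Qed.

Lemma cos_lower x : 1 - x ^+ 2 / 2 <= cos x.
Proof.
rewrite cos_half; have := ler_norm_sin (x / 2).
rewrite -(ler_pXn2r (n := 2))// ?nnegrE// -!normrX !ger0_norm ?sqr_ge0//.
by rewrite exprMn; lra.
Qed.

Lemma sin_sub_le x : `|sin x - x| <= `|x| ^+ 3 / 2.
Proof.
wlog x0 : x / 0 < x.
  move=> H; have [x0|x0|->] := ltgtP x 0; last by rewrite sin0 subrr normr0 expr0n mul0r.
    by rewrite -normrN opprD -sinN -(normrN x) H// oppr_gt0.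
  exact: H.
have [|c] := @MVT R sin cos 0 x x0.
  by apply: continuous_subspaceT => y; exact: continuous_sin.
rewrite in_itv/= sin0 !subr0 => /andP[c0 cx] ->.
have -> : cos c * x - x = - ((1 - cos c) * x) by ring.
rewrite normrN normrM (gtr0_norm x0) ger0_norm ?subr_ge0 ?cos_le1//.
have : (1 - cos c) <= x ^+ 2 / 2.
  have := cos_lower c; have : c ^+ 2 <= x ^+ 2 by rewrite lerXn2r// ?nnegrE ltW.
  by lra.
have -> : x ^+ 3 / 2 = x ^+ 2 / 2 * x by rewrite exprS; field.
by move=> /ler_wpM2r; apply; exact: ltW.
Qed.

(** A crude form of Jordan's inequality:
    [sin x = 2 sin (x / 2) cos (x / 2) >= x cos (x / 2) ^ 2] by the mean value
    theorem, and [cos (x / 2) ^ 2 >= 1 / 2] on the first quadrant. *)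
Lemma sin_lower x : 0 <= x -> x <= pi / 2 -> x / 2 <= sin x.
Proof.
move=> x0 xpi; have [->|xn0] := eqVneq x 0; first by rewrite mul0r sin0.
have y0 : 0 < x / 2 by rewrite divr_gt0// lt_neqAle eq_sym xn0.
have pi2 : 0 < pi :> R := pi_gt0 R.
have [|c] := @MVT R sin cos 0 (x / 2) y0.
  by apply: continuous_subspaceT => y; exact: continuous_sin.
rewrite in_itv/= sin0 !subr0 => /andP[c0 cx] sinE.
have cosc : cos (x / 2) <= cos c.
  by rewrite ltW// ltr_cos ?in_itv/= ?cx//; apply/andP; split; lra.
have cosx : 0 <= cos (x / 2) by apply: cos_ge0_pihalf; apply/andP; split; lra.
have sin2 : sin x = 2 * (sin (x / 2) * cos (x / 2)).
  by rewrite {1}[x]splitr sinD; ring.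
have cosx0 : 0 <= cos x by apply: cos_ge0_pihalf; apply/andP; split; lra.
have cos2 : 2^-1 <= cos (x / 2) ^+ 2.
  have := cos_half x; have := cos2Dsin2 (x / 2); lra.
rewrite sin2 sinE.
have h1 : cos (x / 2) * cos (x / 2) <= cos c * cos (x / 2) by rewrite ler_wpM2r.
rewrite -expr2 in h1.
have -> : 2 * (cos c * (x / 2) * cos (x / 2)) = x * (cos c * cos (x / 2)) by field.
by apply: ler_wpM2l => //; lra.
Qed.

Lemma cabs_cexp_sub1 x : cabs (cexp x - 1) = 2 * `|sin (x / 2)|.
Proof.
apply/eqP; rewrite -(@eqrXn2 _ 2) ?cabs_ge0 ?mulr_ge0//; apply/eqP.
rewrite cabs_sqr /= oppr0 addr0 exprMn -normrX ger0_norm ?sqr_ge0//.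
have := cos2Dsin2 x; have := cos_half x; move: (sin (x / 2)) => v.
have -> : (cos x - 1) ^+ 2 + sin x ^+ 2 = cos x ^+ 2 + sin x ^+ 2 + 1 - 2 * cos x.
  by ring.
by move=> -> ->; ring.
Qed.

Lemma cabs_euler_point_lower h omega : 0 < h -> `|h * omega| <= pi ->
  `|omega| / 2 <= cabs (euler_point h omega).
Proof.
move=> h0 hpi; rewrite /euler_point cabsM cabsV cabs_real (gtr0_norm h0).
rewrite cabs_cexp_sub1 ler_pdivlMr//.
have -> : `|sin (h * omega / 2)| = `|sin (`|h * omega / 2|)|.
  have [y0|y0] := leP 0 (h * omega / 2); first by rewrite (ger0_norm y0).
  by rewrite (ltr0_norm y0) sinN normrN.
have := @sin_lower (`|h * omega / 2|) (normr_ge0 _).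
have -> : `|h * omega / 2| = h * `|omega| / 2.
  by rewrite !normrM (gtr0_norm h0) normfV normr_nat.
move: hpi; rewrite normrM (gtr0_norm h0) => hpi /(_ _)sl.
have {}sl : h * `|omega| / 2 / 2 <= sin (h * `|omega| / 2) by apply: sl; lra.
by have := ler_norm (sin (h * `|omega| / 2)); lra.
Qed.

(** This is the equation [|1 + h s| = 1] of the Euler circle. *)
Lemma Re_euler_point h omega : 0 < h ->
  complex.Re (euler_point h omega) = - (h * cabs (euler_point h omega) ^+ 2) / 2.
Proof.
move=> h0; set s := euler_point h omega.
have sE : 1 + h%:C * s = cexp (h * omega).
  by rewrite /s /euler_point mulrC divfK ?fmorph_eq0 ?gt_eqF// addrC subrK.
have : cabs (1 + h%:C * s) ^+ 2 = 1 by rewrite sE cabs_cexp expr1n.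
rewrite !cabs_sqr; case: s {sE} => a b /=; rewrite !mul0r subr0 addr0 add0r => H.
have h2 : h * (2 * a + h * (a ^+ 2 + b ^+ 2)) = 0.
  have -> : h * (2 * a + h * (a ^+ 2 + b ^+ 2)) = (1 + h * a) ^+ 2 + (h * b) ^+ 2 - 1.
    by ring.
  by rewrite H subrr.
have : 2 * a + h * (a ^+ 2 + b ^+ 2) = 0.
  by apply: (mulfI (lt0r_neq0 h0)); rewrite h2 mulr0.
by lra.
Qed.

(** Taylor expansion of [e^(i h omega)]; the bound is locally uniform in
    [omega], since the frequency will move with [h]. *)
Lemma euler_point_sub h omega : 0 < h ->
  cabs (euler_point h omega - (0 +i* omega)) <=
  h * omega ^+ 2 / 2 + h ^+ 2 * `|omega| ^+ 3 / 2.
Proof.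
move=> h0; have hC0 : h%:C != 0 by rewrite fmorph_eq0 gt_eqF.
have -> : euler_point h omega - (0 +i* omega) =
    (cexp (h * omega) - 1 - (0 +i* (h * omega))) / h%:C.
  have -> : (0 +i* (h * omega) : R[i]) = h%:C * (0 +i* omega).
    by apply/eqP; rewrite eq_complex /= !mul0r mulr0 subrr addr0 !eqxx.
  by rewrite /euler_point; field.
rewrite cabsM cabsV cabs_real (gtr0_norm h0) ler_pdivrMr//.
have -> : cexp (h * omega) - 1 - (0 +i* (h * omega)) =
    (cos (h * omega) - 1)%:C + (0 +i* 1) * (sin (h * omega) - h * omega)%:C.
  by apply/eqP; rewrite eq_complex /=; apply/andP; split; apply/eqP; ring.
rewrite (le_trans (cabsD _ _))// cabsM !cabs_real.
rewrite cabs_i mul1r mulrDl lerD//.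
  rewrite distrC ger0_norm ?subr_ge0 ?cos_le1//.
  by have := cos_lower (h * omega); rewrite exprMn; lra.
rewrite (le_trans (sin_sub_le _))// normrM (gtr0_norm h0) exprMn.
by rewrite [in leLHS]exprSr; lra.
Qed.

End EulerCircle.

(** * Continuity and decay of the transfer matrix *)

Section ModulusConvergence.
Variables (R : realType) (T : Type) (F : set_system T).
Context {FF : Filter F}.
Implicit Types (u v : T -> R[i]) (a b : R[i]).

(** Convergence of complex-valued functions, stated through the real modulus. *)
Definition ccvg u a := cabs (u x - a) @[x --> F] --> (0 : R).

Lemma ccvg_le u a (g : T -> R) : (\forall x \near F, cabs (u x - a) <= g x) ->
  g x @[x --> F] --> 0 -> ccvg u a.
Proof.
move=> ug g0; apply: (@squeeze_cvgr _ _ _ _ (fun=> 0) g) => //; last exact: cvg_cst.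
by apply: filterS ug => x ug; rewrite cabs_ge0.
Qed.

Lemma ccvg_cst a : ccvg (fun=> a) a.
Proof. by rewrite /ccvg subrr cabs0; exact: cvg_cst. Qed.

Lemma ccvgD u v a b : ccvg u a -> ccvg v b -> ccvg (fun x => u x + v x) (a + b).
Proof.
move=> ua vb; apply: (@ccvg_le _ _ (fun x => cabs (u x - a) + cabs (v x - b))).
  by near=> x; rewrite opprD addrACA cabsD.
by rewrite -[X in _ --> X](addr0 0); exact: cvgD.
Unshelve. all: by end_near. Qed.

Lemma ccvg_cabs u a : ccvg u a -> cabs (u x) @[x --> F] --> cabs a.
Proof.
move=> ua; apply/cvgrPdist_le => e e0; move/cvgrPdist_le : ua => /(_ e e0).
apply: filterS => x; rewrite sub0r normrN ger0_norm ?cabs_ge0//.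
apply: le_trans; rewrite ler_norml; apply/andP; split.
  by rewrite lerNl opprB lerBlDr (le_trans _ (cabsD _ _))// subrK.
by rewrite cabsB lerBlDr (le_trans _ (cabsD _ _))// subrK.
Qed.

Lemma ccvgM u v a b : ccvg u a -> ccvg v b -> ccvg (fun x => u x * v x) (a * b).
Proof.
move=> ua vb; apply: (@ccvg_le _ _ (fun x =>
    cabs (u x) * cabs (v x - b) + cabs (u x - a) * cabs b)).
  near=> x; rewrite -!cabsM (le_trans _ (cabsD _ _))//.
  by rewrite mulrBr mulrBl addrA subrK.
have := cvgD (cvgM (ccvg_cabs ua) vb) (cvgM ua (cvg_cst (cabs b))).
by rewrite mulr0 mul0r addr0 => /(_ FF FF FF FF); exact.
Unshelve. all: by end_near. Qed.

Lemma ccvgV u a : a != 0 -> ccvg u a -> ccvg (fun x => (u x)^-1) a^-1.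
Proof.
move=> a0 ua; have ca0 : 0 < cabs a by rewrite cabs_gt0.
have cu := ccvg_cabs ua.
apply: (@ccvg_le _ _ (fun x => cabs (u x - a) * ((cabs (u x))^-1 * (cabs a)^-1))).
  have : \forall x \near F, 0 < cabs (u x) by exact: (cvgr_gt _ cu).
  apply: filterS => x; rewrite cabs_gt0 => ux0.
  rewrite -!cabsV -!cabsM cabsB.
  rewrite [X in cabs X <= _](_ : _ = (u x - a) * ((u x)^-1 * a^-1))//.
  by field; apply/andP; split.
have := cvgM ua (cvgM (cvgV (lt0r_neq0 ca0) cu) (cvg_cst (cabs a)^-1)).
by rewrite mul0r => cvgE; exact: cvgE.
Qed.

Lemma ccvg_horner (q : {poly R[i]}) u a : ccvg u a -> ccvg (fun x => q.[u x]) q.[a].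
Proof.
move=> ua; elim/poly_ind : q => [|q c IH].
  by rewrite horner0; under eq_fun do rewrite horner0; exact: ccvg_cst.
rewrite hornerMXaddC; under eq_fun do rewrite hornerMXaddC.
by apply: ccvgD; [exact: ccvgM | exact: ccvg_cst].
Qed.

Lemma ccvg_ratf_eval (f : {fraction {poly R[i]}}) u a :
  ~~ ratf_pole f a -> ccvg u a -> ccvg (fun x => ratf_eval f (u x)) (ratf_eval f a).
Proof.
rewrite /ratf_pole rootE => fa ua; apply: ccvgM; first exact: ccvg_horner.
by apply: ccvgV => //; exact: ccvg_horner.
Qed.

End ModulusConvergence.

Lemma powRN_le (R : realType) (b x y : R) : 0 <= b -> 0 < x -> x <= y ->
  y `^ (- b) <= x `^ (- b).
Proof.
move=> b0 x0 xy; have y0 := lt_le_trans x0 xy.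
rewrite !powRN lef_pV2 ?posrE ?powR_gt0//.
by rewrite ge0_ler_powR ?nnegrE ?(ltW x0) ?(ltW y0)//.
Qed.

Section TransferBounds.
Variables (R : realType) (N P Q : nat).
Variables (A : 'M[R]_N) (B : 'M[R]_(N, P)) (C : 'M[R]_(Q, N)).
Variables (p : \bar R) (delta beta M K : R).
Hypothesis p1 : (1 <= p)%E.
Hypothesis delta0 : 0 < delta.
Hypothesis stable : forall i j z, ratf_pole (transfer A B C i j) z ->
  complex.Re z <= - delta.
Local Notation H := (transfer_at A B C).

Lemma opnorm_transfer_cvg (T : Type) (F : set_system T) {FF : Filter F}
    (u : T -> R[i]) (a : R[i]) : - delta < complex.Re a -> ccvg F u a ->
  opnorm p (H (u x)) @[x --> F] --> opnorm p (H a).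
Proof.
move=> Rea ua; apply: opnorm_cvg => // i j.
rewrite (mxE _ _ i j); under eq_fun do rewrite (mxE _ _ i j).
apply: ccvg_ratf_eval => //; apply/negP => /stable.
by rewrite leNgt Rea.
Qed.

(** To the right of the poles the denominators are bounded away from 0, and the
    numerators are polynomials. *)
Lemma opnorm_transfer_bounded (r : R) : exists c : R, forall s,
  cabs s <= r -> - delta / 2 <= complex.Re s -> opnorm p (H s) <= c.
Proof.
have entry (i : 'I_Q) (j : 'I_P) : exists c : R, forall s,
    cabs s <= r -> - delta / 2 <= complex.Re s -> cabs (H s i j) <= c.
  pose f := transfer A B C i j.
  have [||e e0 eP] := @poly_lower_bound R (ratf_den f)
      [set s | - delta / 2 <= complex.Re s] (delta / 2) (ratf_den_neq0 f).
  - by rewrite divr_gt0.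
  - move=> z s /stable zd /= sd; rewrite (le_trans _ (normRe_cabs _))//.
    rewrite (le_trans _ (ler_norm _))// raddfB /=.
    by lra.
  exists ((\sum_(k < size (ratf_num f)) cabs (ratf_num f)`_k * r ^+ k) / e).
  move=> s sr sd; rewrite mxE -/f /ratf_eval cabsM cabsV.
  apply: ler_pM; rewrite ?cabs_ge0 ?invr_ge0 ?cabs_ge0//.
    exact: poly_upper_bound.
  by rewrite lef_pV2 ?posrE ?(lt_le_trans e0)//; exact: eP.
have [c cP] := choice (fun ij : 'I_Q * 'I_P => entry ij.1 ij.2).
exists (\sum_i \sum_j c (i, j)) => s sr sd.
rewrite (le_trans (opnorm_le_sum p1 _))//.
by apply: ler_sum => i _; apply: ler_sum => j _; exact: (cP (i, j)).
Qed.

Hypothesis beta1 : 1 < beta.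
Hypothesis M0 : 0 < M.
Hypothesis K0 : 0 < K.
Hypothesis decay : forall s, K <= cabs s -> opnorm p (H s) <= M * cabs s `^ (- beta).

(** The decay at infinity and the boundedness near the imaginary axis, in one
    estimate. *)
Lemma opnorm_transfer_decay : exists2 D : R, 0 < D & forall s,
  (cabs s <= K -> - delta / 2 <= complex.Re s) ->
  opnorm p (H s) <= D * (1 + cabs s) `^ (- beta).
Proof.
have beta0 : 0 <= beta by rewrite ltW// (lt_trans _ beta1).
have [c cP] := opnorm_transfer_bounded K.
have K1 : 0 < 1 + K by rewrite addr_gt0.
have q0 : 0 < K / (1 + K) by rewrite divr_gt0.
pose D0 := `|c| / (1 + K) `^ (- beta); pose D1 := M * (K / (1 + K)) `^ (- beta).
have D00 : 0 <= D0 by rewrite divr_ge0 ?powR_ge0.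
have D10 : 0 < D1 by rewrite mulr_gt0 ?powR_gt0.
exists (D0 + D1); first by rewrite ltr_wpDl.
move=> s sRe; have s0 := cabs_ge0 s; have s1 : 0 < 1 + cabs s by rewrite ltr_wpDr.
rewrite mulrDl; have [Ks|sK] := leP K (cabs s).
  rewrite (le_trans (decay Ks))// ler_wpDl ?(mulr_ge0 D00 (powR_ge0 _ _))//.
  rewrite /D1 -mulrA ler_wpM2l ?(ltW M0)// -powRM ?(ltW q0) ?(ltW s1)//.
  apply: powRN_le => //; first by rewrite mulr_gt0.
  by rewrite mulrAC ler_pdivrMr//; lra.
apply: (@le_trans _ _ `|c|).
  by rewrite (le_trans _ (ler_norm _))// cP ?sRe ?ltW.
rewrite ler_wpDr ?(mulr_ge0 (ltW D10) (powR_ge0 _ _))//.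
rewrite /D0 mulrAC ler_pdivlMr ?powR_gt0// ler_wpM2l//.
by apply: powRN_le => //; rewrite lerD2l ltW.
Qed.

End TransferBounds.

(** * Integrability of the dominating function *)

Section PowerTail.
Variable R : realType.
Local Notation mu := (@lebesgue_measure R).
Variable beta : R.
Hypothesis beta1 : 1 < beta.

Let f (x : R) := (1 + `|x|) `^ (- beta).
Let F (x : R) := - (beta - 1)^-1 * (1 + x) `^ (1 - beta).

Let is_derive_shift (a x : R) : 0 < 1 + x ->
  is_derive x 1 (fun y => (1 + y) `^ a) (a * (1 + x) `^ (a - 1)).
Proof.
move=> x0.
have := @is_derive1_comp R (fun y => y `^ a) (fun y => 1 + y) x
  _ _ (is_derive1_powR a x0) (is_deriveD (is_derive_cst _ _ _) (is_derive_id _ _)).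
by rewrite add0r mulr1.
Qed.

Let continuous_shift (a x : R) : 0 < 1 + x ->
  {for x, continuous (fun y : R => (1 + y) `^ a)}.
Proof.
move=> x0; apply: differentiable_continuous; apply/derivable1_diffP.
by have [] := is_derive_shift a x0.
Qed.

Let continuous_f : continuous f.
Proof.
move=> x; have x0 : 0 < 1 + `|x| by rewrite ltr_wpDr.
have cp := continuous_shift (a := - beta) x0.
apply: (@continuous_comp R R R (fun y => `|y|) (fun y => (1 + y) `^ (- beta))) => //.
exact: norm_continuous.
Qed.

Let F_cvg0 : F x @[x --> +oo] --> (0 : R).
Proof.
have g0 : 0 < beta - 1 by rewrite subr_gt0.
have p0 : (1 + x) `^ (1 - beta) @[x --> +oo] --> (0 : R).
  apply/cvgrPdist_le => e e0; near=> x.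
  have x0 : 0 < e `^ (- (beta - 1)^-1) by rewrite powR_gt0.
  have xe : e `^ (- (beta - 1)^-1) <= 1 + x.
    by apply: (@le_trans _ _ x); [near: x; exact: nbhs_pinfty_ge | rewrite lerDr].
  rewrite sub0r normrN ger0_norm ?powR_ge0// -opprB.
  rewrite (le_trans (powRN_le (ltW g0) x0 xe))//.
  by rewrite -powRrM mulrNN mulVf ?gt_eqF// powRr1// ltW.
rewrite -[X in _ --> X](mulr0 (- (beta - 1)^-1)).
by apply: cvgM => //; exact: cvg_cst.
Unshelve. all: by end_near. Qed.

Lemma integrable_powRN : mu.-integrable [set: R] (EFin \o f).
Proof.
have f0 x : 0 <= f x by exact: powR_ge0.
have mf : measurable_fun [set: R] f by exact: continuous_measurable_fun.
apply/integrableP; split; first exact/measurable_EFinP.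
apply/abse_integralP => //=; first exact/measurable_EFinP.
rewrite ge0_symfun_integralT//; last by move=> x; rewrite /f /= normrN.
have -> : [set x : R | 0 <= x] = `[0, +oo[%classic.
  by apply/seteqP; split => x /=; rewrite in_itv/= andbT.
have -> : (\int[mu]_(x in `[0%R, +oo[) (f x)%:E =
    \int[mu]_(x in `[0%R, +oo[) ((1 + x) `^ (- beta))%:E)%E.
  by apply: eq_integral => x; rewrite inE /= in_itv /= andbT => x0; rewrite /f ger0_norm.
rewrite (@ge0_continuous_FTC2y _ _ F 0 0) => //.
- by rewrite -EFinB -EFinM /= ltry.
- by move=> x _; exact: powR_ge0.
- apply: (@continuous_in_subspaceT _ _ _ (fun x : R => (1 + x) `^ (- beta))) => x.
  rewrite inE /= in_itv/= andbT => x0.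
  by apply: continuous_shift; rewrite ltr_wpDr.
- move=> x x0; apply: derivableM; first exact: derivable_cst.
  by have [] := @is_derive_shift (1 - beta) x _; rewrite // ltr_wpDr// ltW.
- apply: cvg_at_right_filter; apply: cvgM; first exact: cvg_cst.
  by apply: (continuous_shift (a := 1 - beta) (x := 0)); rewrite addr0.
- move=> x; rewrite in_itv /= andbT => x0; rewrite derive1E.
  have x1 : 0 < 1 + x by rewrite ltr_wpDr// ltW.
  have dF := is_deriveM (is_derive_cst (- (beta - 1)^-1) x 1)
    (is_derive_shift (1 - beta) x1).
  rewrite (@derive_val _ _ _ _ _ _ _ dF) /= scaler0 addr0.
  have b0 : beta - 1 != 0 by rewrite gt_eqF// subr_gt0.
  have -> : 1 - beta - 1 = - beta by ring.
  by rewrite /GRing.scale /=; field.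
Qed.

End PowerTail.

(** * Step functions and dominated convergence *)

Section StepFunction.
Variable R : realType.
Local Notation mu := (@lebesgue_measure R).
Variables (n : nat) (x0 d : R) (a : nat -> R).
Hypothesis d0 : 0 < d.
Hypothesis a0 : forall l, 0 <= a l.

Definition cell (l : nat) : set R := `[x0 + l%:R * d, x0 + l.+1%:R * d[%classic.

Definition step (x : R) : R := \sum_(l < n) a l * \1_(cell l) x.

Let measurable_cell l : measurable (cell l).
Proof. exact: measurable_itv. Qed.

Let measurable_term l : measurable_fun setT (fun x => a l * \1_(cell l) x).
Proof. by apply: measurable_funM => //; exact: measurable_indic. Qed.

Lemma measurable_step : measurable_fun setT step.
Proof.
by apply: measurable_sum => l; exact: measurable_term.
Qed.

Lemma integral_step :
  (\int[mu]_x (step x)%:E)%E = (\sum_(l < n) a l * d)%:E.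
Proof.
under eq_integral do rewrite /step -sumEFin.
rewrite ge0_integral_sum//; last 2 first.
- by move=> l; apply/measurable_EFinP; exact: measurable_term.
- by move=> l x _; rewrite lee_fin mulr_ge0// indicE.
rewrite -sumEFin; apply: eq_bigr => l _.
under eq_integral do rewrite EFinM.
have mi : measurable_fun [set: R] (EFin \o (\1_(cell l) : R -> R)).
  by apply/measurable_EFinP; exact: measurable_indic.
rewrite (@ge0_integralZl_EFin _ _ _ mu setT _ (EFin \o (\1_(cell l) : R -> R)))//; last first.
  by move=> x _; rewrite lee_fin.
rewrite integral_indic//; last exact: measurable_cell.
rewrite setIT.
have cellE : mu (cell l) = d%:E.
  rewrite /cell lebesgue_measure_itv /= lte_fin ltrD2l ltr_pM2r// ltr_nat ltnSn.
  by rewrite -EFinB; congr EFin; rewrite -natr1; ring.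
by rewrite EFinM; congr (_ * _)%E; exact: cellE.
Qed.

Lemma cell_inj l k x : cell l x -> cell k x -> l = k.
Proof.
rewrite /cell /= !in_itv /= => /andP[l1 l2] /andP[k1 k2].
have lk : l%:R * d < k.+1%:R * d by lra.
have kl : k%:R * d < l.+1%:R * d by lra.
by move: lk kl; rewrite !ltr_pM2r// !ltr_nat; lia.
Qed.

Lemma step_cell l x : (l < n)%N -> cell l x -> step x = a l.
Proof.
move=> ln lx; rewrite /step (bigD1 (Ordinal ln))//= big1 => [|k kl].
  by rewrite addr0 indicE mem_set ?mulr1.
rewrite indicE memNset ?mulr0// => kx.
by move/eqP : kl; apply; apply: val_inj; exact: cell_inj kx lx.
Qed.

Lemma step_out x : (forall l, (l < n)%N -> ~ cell l x) -> step x = 0.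
Proof.
by move=> nx; rewrite /step big1// => l _; rewrite indicE memNset ?mulr0//; exact: nx.
Qed.

Lemma cell_cover x : x0 <= x -> x < x0 + n%:R * d ->
  exists2 l, (l < n)%N & cell l x.
Proof.
move=> xx0 xn; pose l := Num.trunc ((x - x0) / d).
have q0 : 0 <= (x - x0) / d by rewrite divr_ge0 ?subr_ge0 ?(ltW d0).
have /andP[l1 l2] := truncn_itv q0.
move: l1 l2; rewrite ler_pdivlMr// ltr_pdivrMr// -/l => l1 l2.
exists l; last by rewrite /cell /= in_itv /=; apply/andP; split; lra.
have : l%:R * d < n%:R * d by lra.
by rewrite ltr_pM2r// ltr_nat.
Qed.

Lemma cell_dist l x : cell l x -> `|x0 + l%:R * d - x| <= d.
Proof.
rewrite /cell /= in_itv /= => /andP[l1 l2].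
rewrite -natr1 in l2.
by rewrite distrC ger0_norm; lra.
Qed.

End StepFunction.

Section EulerIntegral.
Variables (R : realType) (N P Q : nat).
Local Notation mu := (@lebesgue_measure R).
Variables (A : 'M[R]_N) (B : 'M[R]_(N, P)) (C : 'M[R]_(Q, N)).
Variables (p : \bar R) (delta beta M K : R).
Hypothesis p1 : (1 <= p)%E.
Hypothesis delta0 : 0 < delta.
Hypothesis stable : forall i j z, ratf_pole (transfer A B C i j) z ->
  complex.Re z <= - delta.
Hypothesis beta1 : 1 < beta.
Hypothesis M0 : 0 < M.
Hypothesis K0 : 0 < K.
Hypothesis decay : forall s, K <= cabs s ->
  opnorm p (transfer_at A B C s) <= M * cabs s `^ (- beta).
Variables (h : nat -> R) (n : nat -> nat).
Hypothesis h0 : forall m, 0 < h m.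
Hypothesis h_small : forall m, h m * K ^+ 2 <= delta.
Hypothesis h_cvg : h m @[m --> \oo] --> (0 : R).
Hypothesis n0 : forall m, (0 < n m)%N.
Hypothesis mesh : forall m, 2 * pi / ((n m)%:R * h m) <= m.+1%:R^-1.

Local Notation Hnorm s := (opnorm p (transfer_at A B C s)).
Local Notation axis w := (0 +i* w : R[i]).

Let d m : R := 2 * pi / ((n m)%:R * h m).
Let node m l : R := angle R (n m) l / h m.
Let sample m l : R := Hnorm (euler_point (h m) (node m l)).
Let g m : R -> R := step (n m) (- pi / h m) (d m) (sample m).

Let n0R m : 0 < (n m)%:R :> R.
Proof. by rewrite ltr0n. Qed.

Let d0 m : 0 < d m.
Proof. by rewrite divr_gt0 ?mulr_gt0 ?pi_gt0. Qed.

Let d1 m : d m <= 1.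
Proof. by rewrite (le_trans (mesh m))// invf_le1 ?ltr0n// ler1n. Qed.

Let sample0 m l : 0 <= sample m l.
Proof. exact: opnorm_ge0. Qed.

Let nodeE m l : node m l = - pi / h m + l%:R * d m.
Proof.
rewrite /node /angle /d; field.
by rewrite !gt_eqF ?n0R ?h0.
Qed.

Let cell_node m l x : cell (- pi / h m) (d m) l x -> `|node m l - x| <= d m.
Proof. by rewrite nodeE; exact: cell_dist. Qed.

Let node_le m l : (l < n m)%N -> `|h m * node m l| <= pi.
Proof.
move=> ln; have -> : h m * node m l = angle R (n m) l.
  by rewrite /node mulrC divfK// gt_eqF.
have pi0 := pi_gt0 R; rewrite /angle ler_norml; apply/andP; split.
  by rewrite lerDl divr_ge0 ?mulr_ge0// ltW.
have : l%:R / (n m)%:R <= 1 :> R.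
  by rewrite ler_pdivrMr// mul1r ler_nat ltnW.
move/(ler_wpM2l (ltW pi0)); lra.
Qed.

(** The step function [g m] takes on each cell the value of the norm at the
    point of the Euler circle above the left end of the cell. As the step size
    and the mesh tend to 0, it converges pointwise to the norm on the imaginary
    axis, and [opnorm_transfer_decay] dominates it. *)
Lemma integrable_transfer_axis :
  mu.-integrable [set: R] (fun w => (Hnorm (axis w))%:E) /\
  (\int[mu]_w (g m w)%:E)%E @[m --> \oo] --> (\int[mu]_w (Hnorm (axis w))%:E)%E.
Proof.
have [D D0 DP] := opnorm_transfer_decay p1 delta0 stable beta1 M0 K0 decay.
have beta0 : 0 <= beta by rewrite ltW// (lt_trans _ beta1).
pose dom (x : R) := D * 2^-1 `^ (- beta) * (1 + `|x|) `^ (- beta).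
have dom0 x : 0 <= dom x by rewrite !mulr_ge0 ?powR_ge0// ltW.
have sample_dom m l x : (l < n m)%N -> cell (- pi / h m) (d m) l x ->
    sample m l <= dom x.
  move=> ln lx; set s := euler_point (h m) (node m l).
  have sRe : cabs s <= K -> - delta / 2 <= complex.Re s.
    move=> sK; rewrite Re_euler_point// -/s.
    have : h m * cabs s ^+ 2 <= h m * K ^+ 2.
      by rewrite ler_wpM2l ?(ltW (h0 m))// lerXn2r ?nnegrE ?cabs_ge0 ?(ltW K0).
    by have := h_small m; lra.
  rewrite (le_trans (DP s sRe))// /dom -mulrA ler_wpM2l ?(ltW D0)//.
  have x1 : 0 < 1 + `|x| by rewrite ltr_wpDr.
  rewrite -powRM ?invr_ge0 ?(ltW x1)//; apply: powRN_le => //.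
  have := cabs_euler_point_lower (h0 m) (node_le ln); rewrite -/s.
  have := le_trans (cell_node lx) (d1 m).
  by have := ler_normB (node m l) (node m l - x); rewrite subKr; lra.
have g_dom m x : 0 <= g m x <= dom x.
  have [[l [ln lx]]|nolx] :=
    pselect (exists l, (l < n m)%N /\ cell (- pi / h m) (d m) l x).
    rewrite /g (step_cell (sample m) (d0 m) ln lx) sample0 /=.
    exact: sample_dom ln lx.
  rewrite /g step_out ?lexx ?dom0// => l ln lx; apply: nolx; by exists l.
have g_cvg x : g m x @[m --> \oo] --> Hnorm (axis x).
  pose y := `|x| + 1.
  pose err m := h m * y ^+ 2 / 2 + h m ^+ 2 * y ^+ 3 / 2 + m.+1%:R^-1.
  have err0 : err m @[m --> \oo] --> (0 : R).
    have c1 : h m * y ^+ 2 / 2 @[m --> \oo] --> 0 * y ^+ 2 / 2.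
      by apply: cvgM; [apply: cvgM => //|]; exact: cvg_cst.
    have c2 : h m ^+ 2 * y ^+ 3 / 2 @[m --> \oo] --> 0 ^+ 2 * y ^+ 3 / 2.
      apply: cvgM; [apply: cvgM|]; [|exact: cvg_cst..].
      by apply: cvgM.
    have := cvgD (cvgD c1 c2) (@cvg_harmonic R).
    by rewrite expr0n !mul0r !addr0 => cE; exact: cE.
  (* The sample point used at [x]; its definition needs [x] to be in the range
     of the grid, which holds for large [m]. *)
  have pick m : exists s : R[i], h m * `|x| < pi ->
      g m x = Hnorm s /\ cabs (s - axis x) <= err m.
    have [hx|] := boolP (h m * `|x| < pi); last by move=> _; exists 0.
    have : `|x| < pi / h m by rewrite ltr_pdivlMr// mulrC.
    rewrite ltr_norml => /andP[xl xr].
    have [l ln lx] : exists2 l, (l < n m)%N & cell (- pi / h m) (d m) l x.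
      apply: cell_cover => //; first by rewrite mulNr ltW.
      have -> : - pi / h m + (n m)%:R * d m = pi / h m => //.
      by rewrite /d; field; rewrite !gt_eqF ?n0R ?h0.
    exists (euler_point (h m) (node m l)) => _; split.
      by rewrite /g (step_cell (sample m) (d0 m) ln lx).
    have nx := cell_node lx.
    have ny : `|node m l| <= y.
      have := le_trans nx (d1 m).
      by have := ler_normD (node m l - x) x; rewrite subrK /y; lra.
    have -> : euler_point (h m) (node m l) - axis x =
        (euler_point (h m) (node m l) - axis (node m l)) +
        (0 +i* 1) * (node m l - x)%:C.
      by rewrite -axisB addrA subrK.
    rewrite (le_trans (cabsD _ _))// cabsM cabs_real cabs_i.
    rewrite mul1r /err lerD ?(le_trans nx (mesh m))//.
    rewrite (le_trans (euler_point_sub _ (h0 m)))//.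
    have n2 : node m l ^+ 2 <= y ^+ 2.
      by rewrite -[node m l ^+ 2]real_normK ?num_real// lerXn2r ?nnegrE ?(le_trans _ ny).
    have n3 : `|node m l| ^+ 3 <= y ^+ 3.
      by rewrite lerXn2r ?nnegrE ?(le_trans _ ny).
    by rewrite lerD// ler_wpM2r// ler_wpM2l// ?exprn_ge0 ?(ltW (h0 m)).
  have [s sP] := choice pick.
  have hx : \forall m \near \oo, h m * `|x| < pi.
    have : h m * `|x| @[m --> \oo] --> (0 : R).
      by rewrite -[X in _ --> X](mul0r `|x|); apply: cvgM => //; exact: cvg_cst.
    by move/cvgr_lt; apply; exact: pi_gt0.
  have s_cvg : ccvg \oo s (axis x).
    apply: ccvg_le err0; apply: filterS hx => m /sP[_]; exact.
  have Hs := opnorm_transfer_cvg p1 stable (a := axis x) _ s_cvg.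
  have {}Hs : Hnorm (s m) @[m --> \oo] --> Hnorm (axis x).
    by apply: Hs; rewrite /= oppr_lt0.
  apply: cvg_trans Hs; apply: near_eq_cvg.
  by apply: filterS hx => m /sP[-> _].
have cont : continuous (fun w => Hnorm (axis w)).
  move=> w; apply: (opnorm_transfer_cvg p1 stable); first by rewrite /= oppr_lt0.
  apply: (@ccvg_le _ _ _ _ _ _ (fun w' => `|w' - w|)).
    by near=> w'; rewrite axisB cabsM cabs_real cabs_i mul1r.
  apply/cvgrPdist_le => e e0; near=> w'.
  rewrite sub0r normrN normr_id distrC; near: w'.
  by apply/nbhs_normP; exists e => //= w' /=; exact: ltW.
have mH : measurable_fun [set: R] (fun w => (Hnorm (axis w))%:E).
  by apply/measurable_EFinP; exact: continuous_measurable_fun.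
have idom : mu.-integrable [set: R] (EFin \o dom).
  have := integrable_powRN beta1.
  by move=> /(integrableZl measurableT (D * 2^-1 `^ (- beta))).
have mg m : measurable_fun [set: R] (fun w => (g m w)%:E).
  by apply/measurable_EFinP; exact: measurable_step.
have g_cvgE : forall w, [set: R] w -> (g m w)%:E @[m --> \oo] --> (Hnorm (axis w))%:E.
  by move=> w _; apply: cvg_EFin; [near=> m | exact: g_cvg].
have g_domE : forall w m, [set: R] w -> (`|(g m w)%:E| <= (EFin \o dom) w)%E.
  move=> w m _; have /andP[g0 gd] := g_dom m w.
  by rewrite /= lee_fin ger0_norm.
have [||//] := @dominated_convergence _ _ R mu setT measurableT
  (fun m w => (g m w)%:E) _ (EFin \o dom) mg mH _ idom _.
- exact: aeW.
- exact: aeW.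
Unshelve. all: by end_near. Qed.

Lemma euler_limit_le (E : nat -> R) (L : R) :
  (forall m, E m <= ((n m)%:R * h m)^-1 *
     \sum_(l < n m) Hnorm (euler_point (h m) (angle R (n m) l / h m)) + m.+1%:R^-1) ->
  E m @[m --> \oo] --> L ->
  (L%:E <= ((2 * pi)^-1)%:E * \int[mu]_(w in [set: R]) (Hnorm (axis w))%:E < +oo)%E.
Proof.
move=> EP EL; have [iH gH] := integrable_transfer_axis.
have := integrable_fin_num measurableT iH; move: gH.
move: (\int[mu]_w (Hnorm (axis w))%:E)%E => [I||//] gH // _.
rewrite -EFinM ltry andbT lee_fin.
have J m : (\int[mu]_w (g m w)%:E)%E = (\sum_(l < n m) sample m l * d m)%:E.
  by rewrite integral_step.
have {}gH : \sum_(l < n m) sample m l * d m @[m --> \oo] --> I.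
  by move: gH; rewrite (funext J) => /fine_cvg.
apply: (ler_cvg_to EL (g := fun m => (2 * pi)^-1 * (\sum_(l < n m) sample m l * d m)
    + m.+1%:R^-1)).
  rewrite -[X in _ --> X]addr0; apply: cvgD; last exact: cvg_harmonic.
  by apply: cvgM => //; exact: cvg_cst.
near=> m; rewrite (le_trans (EP m))// lerD2r -mulr_suml mulrC mulrCA.
rewrite /sample /node ler_wpM2l ?sumr_ge0// => [l _|]; first exact: opnorm_ge0.
by rewrite /d mulrA mulVf ?mul1r ?mulf_neq0 ?pnatr_eq0// gt_eqF ?pi_gt0.
Unshelve. all: by end_near. Qed.

End EulerIntegral.

(** * Euler products converge to the exponential *)

Lemma cvg_invn (R : realType) : m%:R^-1 @[m --> \oo] --> (0 : R).
Proof. by rewrite -cvg_shiftS; exact: cvg_harmonic. Qed.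

Section ExponentialLimit.
Variable R : realType.

Lemma binom_le (m k : nat) : (0 < m)%N ->
  'C(m, k)%:R * m%:R^-1 ^+ k <= k`!%:R^-1 :> R.
Proof.
move=> m0; have m0R : 0 < m%:R ^+ k :> R by rewrite exprn_gt0// ltr0n.
rewrite exprVn ler_pdivrMr// mulrC ler_pdivlMr ?ltr0n ?fact_gt0//.
rewrite -natrM -natrX ler_nat bin_ffact.
elim: k {m0R} => [|k IH]; first by rewrite ffactn0 expn0.
by rewrite ffactnSr expnSr leq_mul// leq_subr.
Qed.

Lemma expR_frac_le (y : R) : 0 <= y -> expR (y / (1 + y)) <= 1 + y.
Proof.
move=> y0; have y1 : 0 < 1 + y by rewrite ltr_wpDr.
rewrite -[leLHS]invrK -expRN -[leRHS]invrK lef_pV2 ?posrE ?invr_gt0 ?expR_gt0//.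
rewrite [leLHS](_ : _ = 1 + - (y / (1 + y))); first exact: expR_ge1Dx.
by field; rewrite gt_eqF.
Qed.

Lemma cvg_euler_expR (a : R) : 0 <= a ->
  series (exp_coeff a) m.+1 - (1 + m%:R^-1 * a) ^+ m @[m --> \oo] --> (0 : R).
Proof.
move=> a0.
have inv0 := @cvg_invn R.
have den1 : 1 + m%:R^-1 * a @[m --> \oo] --> (1 + 0 * a : R).
  by apply: cvgD; [|apply: cvgM => //]; exact: cvg_cst.
have quo : a / (1 + m%:R^-1 * a) @[m --> \oo] --> a / (1 + 0 * a).
  apply: cvgM; first exact: cvg_cst.
  by apply: cvgV => //; rewrite mul0r addr0.
rewrite mul0r addr0 divr1 in quo.
have lim0 : expR a - expR (a / (1 + m%:R^-1 * a)) @[m --> \oo] --> expR a - expR a.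
  by apply: cvgB; [exact: cvg_cst | exact: (continuous_cvg _ (@continuous_expR R a) quo)].
rewrite subrr in lim0.
apply: (@squeeze_cvgr _ _ _ _ (fun=> 0) _ _ _ _ _ lim0); last exact: cvg_cst.
near=> m; have m0 : (0 < m)%N by near: m; exact: nbhs_infty_gt.
have m0R : 0 < m%:R :> R by rewrite ltr0n.
have y0 : 0 <= m%:R^-1 * a by rewrite mulr_ge0 ?invr_ge0.
apply/andP; split.
  rewrite subr_ge0 exprDn /series /= big_mkord; apply: ler_sum => k _.
  rewrite expr1n mul1r exprMn -mulr_natl mulrA /exp_coeff /= [leRHS]mulrC.
  by rewrite ler_wpM2r ?exprn_ge0// binom_le.
apply: lerB.
  apply: (nondecreasing_cvgn_le (u_ := series (exp_coeff a))).
    by apply: nondecreasing_series => k _ _; exact: exp_coeff_ge0.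
  exact: is_cvg_series_exp_coeff.
have -> : a / (1 + m%:R^-1 * a) = m%:R * (m%:R^-1 * a / (1 + m%:R^-1 * a)).
  by rewrite !mulrA mulfV ?mul1r ?gt_eqF.
by rewrite expRM_natl lerXn2r ?nnegrE ?expR_ge0 ?expR_frac_le// addr_ge0.
Unshelve. all: by end_near. Qed.

Variables (N : nat) (X : 'M[R]_N).

Let expmxZ (c : R) k : (c *: X) ^+ k = c ^+ k *: X ^+ k.
Proof.
elim: k => [|k IH]; first by rewrite !expr0 scale1r.
rewrite !exprS IH -[LHS]/((c *: X) *m (c ^+ k *: X ^+ k)).
by rewrite -scalemxAl -scalemxAr scalerA.
Qed.

Lemma matrix_exp_entry_le (k : nat) i j :
  `|(X ^+ k) i j| <= (\sum_i \sum_j `|X i j|) ^+ k.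
Proof.
set a := \sum_i _.
elim: k i j => [|k IH] i j.
  by rewrite !expr0 mxE; case: eqP => _; rewrite ?mulr1n ?mulr0n ?normr1 ?normr0.
rewrite exprS -[X * X ^+ k]/(X *m X ^+ k) mxE (le_trans (ler_norm_sum _ _ _))//.
apply: (@le_trans _ _ (\sum_l `|X i l| * a ^+ k)).
  by apply: ler_sum => l _; rewrite normrM ler_wpM2l.
rewrite -mulr_suml exprS ler_wpM2r//.
  by rewrite exprn_ge0//; do 2 apply: sumr_ge0 => ? _.
rewrite /a [leRHS](bigD1 i)//= lerDl.
by do 2 apply: sumr_ge0 => ? _.
Qed.

Let a := \sum_i \sum_j `|X i j|.
Let a0 : 0 <= a.
Proof. by do 2 apply: sumr_ge0 => ? _. Qed.

Let coeff i j (k : nat) : R := k`!%:R^-1 * (X ^+ k) i j.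

Let cvg_coeff i j : cvgn (series (coeff i j)).
Proof.
apply: normed_cvg; apply: (series_le_cvg (v_ := exp_coeff a)).
- by move=> k /=.
- by move=> k; exact: exp_coeff_ge0.
- move=> k /=; rewrite normrM ger0_norm ?invr_ge0// /exp_coeff /= [leRHS]mulrC.
  by rewrite ler_wpM2l ?invr_ge0// matrix_exp_entry_le.
- exact: is_cvg_series_exp_coeff.
Qed.

Lemma expmx_entry i j : series (coeff i j) m @[m --> \oo] --> expmx X i j.
Proof.
pose E : 'M[R]_N := \matrix_(i, j) limn (series (coeff i j)).
suff EX : series (fun k : nat => (k`!%:R)^-1 *: X ^+ k) m @[m --> \oo] --> E.
  by rewrite /expmx (cvg_lim _ EX)// mxE; exact: cvg_coeff.
apply/cvg_mx_entourageP => U entU.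
have : \forall m \near \oo, forall ij : 'I_N * 'I_N,
    (E ij.1 ij.2, series (fun k : nat => (k`!%:R)^-1 *: X ^+ k) m ij.1 ij.2) \in U.
  apply: filter_forall => -[k l] /=.
  have /cvg_entourageP/(_ U entU) := @cvg_coeff k l.
  move=> cU; have {}cU : \forall m \near \oo,
      U (limn (series (coeff k l)), series (coeff k l) m) by exact: cU.
  apply: filterS cU => m; rewrite [E k l]mxE.
  have -> : series (fun k : nat => (k`!%:R)^-1 *: X ^+ k) m k l = series (coeff k l) m.
    rewrite /series /= summxE; apply: eq_bigr => q _.
    by rewrite mxE.
  by move=> ?; exact/mem_set.
by apply: filterS => m mU i' j'; exact: (mU (i', j')).
Qed.

(** Euler's formula for the exponential. The difference between the partial sum
    of the exponential series and the Euler product has coefficients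
    [1/k! - binomial(m,k)/m^k >= 0], so it is dominated entrywise by the same
    difference for the scalar [a]. *)
Lemma cvg_euler_expmx i j :
  ((1%:M + m%:R^-1 *: X) ^+ m) i j @[m --> \oo] --> expmx X i j.
Proof.
have partial : series (coeff i j) m.+1 @[m --> \oo] --> expmx X i j.
  by rewrite (cvg_shiftS (series (coeff i j))); exact: expmx_entry.
have diff0 : series (coeff i j) m.+1 - ((1%:M + m%:R^-1 *: X) ^+ m) i j
    @[m --> \oo] --> (0 : R).
  apply/norm_cvg0P.
  apply: (@squeeze_cvgr _ _ _ _ (fun=> 0) _ _ _ _ _ (cvg_euler_expR a0));
    last exact: cvg_cst.
  near=> m; have m0 : (0 < m)%N by near: m; exact: nbhs_infty_gt.
  rewrite normr_ge0 /=.
  have -> : ((1%:M + m%:R^-1 *: X) ^+ m) i j =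
      \sum_(k < m.+1) 'C(m, k)%:R * m%:R^-1 ^+ k * (X ^+ k) i j.
    rewrite addrC exprD1n summxE; apply: eq_bigr => k _.
    by rewrite expmxZ -scaler_nat scalerA mxE.
  rewrite /series /= !big_mkord exprDn -!sumrB (le_trans (ler_norm_sum _ _ _))//.
  apply: ler_sum => k _.
  rewrite -mulrBl normrM ger0_norm ?subr_ge0 ?binom_le//.
  have -> : exp_coeff a k - 1 ^+ (m - k) * (m%:R^-1 * a) ^+ k *+ 'C(m, k) =
      (k`!%:R^-1 - 'C(m, k)%:R * m%:R^-1 ^+ k) * a ^+ k.
    by rewrite /exp_coeff /= expr1n mul1r exprMn -[X in _ - X]mulr_natl; ring.
  by rewrite ler_wpM2l ?subr_ge0 ?binom_le// matrix_exp_entry_le.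
have cvgE : series (coeff i j) m.+1 -
    (series (coeff i j) m.+1 - ((1%:M + m%:R^-1 *: X) ^+ m) i j)
    @[m --> \oo] --> expmx X i j - 0 by exact: cvgB.
by move: cvgE; rewrite subr0; under eq_fun do rewrite subKr.
Unshelve. all: by end_near. Qed.

End ExponentialLimit.

(** * The bound *)

(** [|1 + h z|^2 = 1 + h (2 Re z + h |z|^2)]. *)
Lemma cabs_euler_factor (R : realType) (h delta rho : R) (z : R[i]) :
  0 < delta -> 0 < h -> h * rho ^+ 2 <= delta ->
  complex.Re z <= - delta -> cabs z <= rho -> cabs (1 + h%:C * z) < 1.
Proof.
move=> delta0 h0 hrho zd zr.
have zr2 : cabs z ^+ 2 <= rho ^+ 2.
  by rewrite lerXn2r ?nnegrE ?cabs_ge0// (le_trans (cabs_ge0 z)).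
have -> : (cabs (1 + h%:C * z) < 1) = (cabs (1 + h%:C * z) ^+ 2 < 1).
  by rewrite expr_lt1// cabs_ge0.
move: zr2; rewrite !cabs_sqr; case: z zd {zr} => u v /= ud uv.
rewrite !mul0r subr0 addr0 add0r.
have -> : (1 + h * u) ^+ 2 + (h * v) ^+ 2 =
    1 + h * (2 * u + h * (u ^+ 2 + v ^+ 2)) by ring.
have h2 : h * (u ^+ 2 + v ^+ 2) <= delta.
  by apply: le_trans hrho; rewrite ler_wpM2l// ltW.
by rewrite gtrDl pmulr_rlt0//; lra.
Qed.

Section Assembly.
Variables (R : realType) (N' P Q : nat).
Local Notation mu := (@lebesgue_measure R).
Variables (A : 'M[R]_N'.+1) (B : 'M[R]_(N'.+1, P)) (C : 'M[R]_(Q, N'.+1)).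
Variables (p : \bar R) (beta M K : R).
Hypothesis st : io_stable A B C.
Hypothesis p1 : (1 <= p)%E.
Hypothesis beta1 : 1 < beta.
Hypothesis M0 : 0 < M.
Hypothesis K0 : 0 < K.
Hypothesis decay : forall s, K <= cabs s ->
  opnorm p (transfer_at A B C s) <= M * cabs s `^ (- beta).

(** A limit of explicit Euler approximations is bounded by the integral. The
    number [k] of steps is arbitrary, so that it can be chosen according to [t].
    The shift by [r] makes even the first step sizes small enough for stability;
    the number [n m] of sample points is then taken large enough for the
    remainder, for the mesh and for [k < n m]. *)
Lemma euler_scheme_limit (tau L : R) (k : nat -> nat) : 0 < tau ->
  (exists m0 : nat, forall r : nat, (m0 <= r)%N -> (0 < r)%N ->
     opnorm p (cplxmx (C *m (1%:M + (tau / (m + r)%:R) *: A) ^+ k (m + r)%N *m B))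
       @[m --> \oo] --> L) ->
  (L%:E <= ((2 * pi)^-1)%:E * \int[mu]_(w in [set: R])
     (opnorm p (transfer_at A B C (0 +i* w)))%:E < +oo)%E.
Proof.
move=> tau0 [m0 EL].
have [delta [rho [delta0 rho0 poles]]] := io_stable_uniform st.
have c0 : 0 < rho ^+ 2 + K ^+ 2 by rewrite addr_gt0 ?exprn_gt0.
(* large enough for [tau / r * (rho^2 + K^2) <= delta] *)
pose r := (maxn m0 (Num.trunc (tau * (rho ^+ 2 + K ^+ 2) / delta))).+1.
have rlarge : tau * (rho ^+ 2 + K ^+ 2) / delta <= r%:R.
  rewrite (le_trans (ltW (truncnS_gt _)))// ler_nat ltnS.
  by rewrite leq_maxr.
pose h m : R := tau / (m + r)%:R.
have mr0 m : 0 < (m + r)%:R :> R by rewrite ltr0n addnS.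
have h0 m : 0 < h m by rewrite divr_gt0.
have h_small m : h m * (rho ^+ 2 + K ^+ 2) <= delta.
  rewrite /h mulrAC ler_pdivrMr//; move: rlarge; rewrite ler_pdivrMr//.
  move/le_trans; apply; rewrite mulrC ler_wpM2l ?(ltW delta0)//.
  by rewrite ler_nat leq_addl.
have h_rho m : h m * rho ^+ 2 <= delta.
  by apply: le_trans (h_small m); rewrite ler_wpM2l ?lerDl ?sqr_ge0// ltW.
have h_K m : h m * K ^+ 2 <= delta.
  by apply: le_trans (h_small m); rewrite ler_wpM2l ?lerDr ?sqr_ge0// ltW.
have h_cvg : h m @[m --> \oo] --> (0 : R).
  have inv0 : (m + r)%:R^-1 @[m --> \oo] --> (0 : R).
    by rewrite (cvg_shiftn r (fun m => m%:R^-1 : R)); exact: cvg_invn.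
  by rewrite -[X in _ --> X](mulr0 tau); apply: cvgM => //; exact: cvg_cst.
have stable m i j z : ratf_pole (transfer A B C i j) z -> cabs (1 + (h m)%:C * z) < 1.
  by move=> /poles[zd zr]; exact: cabs_euler_factor (h_rho m) zd zr.
have pick m : exists n : nat, [/\ (0 < n)%N, 2 * pi / (n%:R * h m) <= m.+1%:R^-1 &
    opnorm p (cplxmx (C *m (1%:M + h m *: A) ^+ k (m + r)%N *m B)) <=
    (n%:R * h m)^-1 * \sum_(l < n)
      opnorm p (transfer_at A B C (euler_point (h m) (angle R n l / h m))) + m.+1%:R^-1].
  have e0 : 0 < m.+1%:R^-1 :> R by rewrite invr_gt0 ltr0n.
  have near_bound := euler_opnorm_bound p1 (h0 m) (stable m) e0.
  have near_k := nbhs_infty_gt (k (m + r)%N).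
  have near_mesh := nbhs_infty_ger (2 * pi / h m * m.+1%:R).
  have [n [[bound kn] mesh]] := filter_ex (filterI (filterI near_bound near_k) near_mesh).
  have n0 : (0 < n)%N by rewrite (leq_ltn_trans _ kn).
  exists n; split=> //; last exact: bound.
  rewrite invfM [n%:R^-1 * _]mulrC mulrA ler_pdivrMr ?ltr0n//.
  by rewrite ler_pdivlMl ?ltr0n// mulrC.
have [n nP] := choice pick.
have poleRe i j z : ratf_pole (transfer A B C i j) z -> complex.Re z <= - delta.
  by move=> /poles[].
apply: (euler_limit_le p1 delta0 poleRe beta1 M0 K0 decay h0 h_K h_cvg
  (n := n) _ _ (E := fun m =>
     opnorm p (cplxmx (C *m (1%:M + h m *: A) ^+ k (m + r)%N *m B)))).
- by move=> m; have [] := nP m.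
- by move=> m; have [] := nP m.
- by move=> m; have [] := nP m.
- by apply: EL => //; rewrite /r leqW// leq_maxl.
Qed.

Lemma opnorm_expmx_cvg (X : 'M[R]_N'.+1) :
  opnorm p (cplxmx (C *m (1%:M + m%:R^-1 *: X) ^+ m *m B)) @[m --> \oo] -->
  opnorm p (cplxmx (C *m expmx X *m B)).
Proof.
apply: opnorm_cvg => // i j.
have entry (Y : 'M[R]_N'.+1) :
    (C *m Y *m B) i j = \sum_l \sum_q C i q * Y q l * B l j.
  rewrite mxE; apply: eq_bigr => l _; rewrite mxE mulr_suml.
  by apply: eq_bigr => q _.
have cvgE : (C *m (1%:M + m%:R^-1 *: X) ^+ m *m B) i j @[m --> \oo] -->
    (C *m expmx X *m B) i j.
  rewrite entry; under eq_fun do rewrite entry.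
  apply: (cvg_sumr (f := fun l m =>
    \sum_q C i q * ((1%:M + m%:R^-1 *: X) ^+ m) q l * B l j)) => l.
  apply: (cvg_sumr (f := fun q m =>
    C i q * ((1%:M + m%:R^-1 *: X) ^+ m) q l * B l j)) => q.
  apply: cvgM; last exact: cvg_cst.
  apply: cvgM; first exact: cvg_cst.
  exact: cvg_euler_expmx.
under eq_fun do rewrite !mxE -rmorphB cabs_real.
apply/cvgrPdist_le => e e0; move/cvgrPdist_le : cvgE => /(_ e e0).
apply: filterS => m; rewrite sub0r normrN normr_id distrC.
by rewrite !mxE.
Qed.

Lemma opnorm_expmx_le (t : R) : 0 <= t ->
  ((opnorm p (cplxmx (C *m expmx (t *: A) *m B)))%:E <=
   ((2 * pi)^-1)%:E * \int[mu]_(w in [set: R])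
     (opnorm p (transfer_at A B C (0 +i* w)))%:E < +oo)%E.
Proof.
have shift r (f g : nat -> R) (L : R) : (forall m, f (m + r)%N = g m) ->
    f m @[m --> \oo] --> L -> g m @[m --> \oo] --> L.
  by move=> /funext <-; rewrite (cvg_shiftn r f).
rewrite le_eqVlt => /predU1P[<-|t0].
  (* no step at all: the Euler approximation is constant *)
  apply: (@euler_scheme_limit 1 _ (fun=> 0%N)) => //; exists 0%N => r _ _.
  apply: (shift r) (@opnorm_expmx_cvg (0 *: A)) => m.
  by rewrite scale0r scaler0 addr0 expr1n.
apply: (@euler_scheme_limit t _ id) => //; exists 0%N => r _ _.
apply: (shift r) (@opnorm_expmx_cvg (t *: A)) => m.
by rewrite scalerA mulrC.
Qed.

End Assembly.

Unset Implicit Arguments.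
Set Strict Implicit.

Theorem theorem6 (R : realType) (N P Q : nat)
    (A : 'M[R]_N) (B : 'M[R]_(N, P)) (C : 'M[R]_(Q, N))
    (p : \bar R) (beta M K : R) :
  io_stable A B C ->
  (1 <= p)%E ->
  1 < beta -> 0 < M -> 0 < K ->
  (forall s : R[i], K <= cabs s ->
     opnorm p (transfer_at A B C s) <= M * cabs s `^ (- beta)) ->
  forall t : R, 0 <= t ->
    ((opnorm p (cplxmx (C *m expmx (t *: A) *m B)))%:E <=
       ((2 * pi)^-1)%:E *
         \int[lebesgue_measure]_(w in [set: R])
            (opnorm p (transfer_at A B C (0 +i* w)))%:E
     < +oo)%E.
Proof.
(* In dimension 0 both sides vanish. *)
case: N A B C => [|N'] A B C; last first.
  by move=> st p1 beta1 M0 K0 decay t t0; exact: opnorm_expmx_le decay _ t0.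
move=> _ p1 _ _ _ _ t _.
have C0 (Y : 'M[R]_0) : C *m Y *m B = 0 by rewrite (thinmx0 (C *m Y)) mul0mx.
have H0 s : transfer_at A B C s = 0.
  apply/matrixP => i j; rewrite !mxE big_ord0.
  have n0 : ratf_num (0 : {fraction {poly R[i]}}) = 0.
    by apply/eqP; rewrite -tofrac_eq0 -mul_ratf_den mul0r.
  by rewrite /ratf_eval n0 horner0 mul0r.
rewrite C0 /cplxmx map_mx0 opnorm0//.
under eq_integral do rewrite H0 opnorm0//.
by rewrite integral0 mule0 lexx ltry.
Qed.
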